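(* Let $n,d\ge 1$, $0<\mu\le L$, $\kappa:=L/\mu$, and let $f_1,\dots,f_n,f_s,g:\mathbb{R}^d\to\mathbb{R}$ be $L$-smooth and $\mu$-strongly convex. Let $x^\star$ be the unique minimizer of $\frac1n\sum_{i=1}^n f_i(x)+2f_s(x)+g(x)$ over $\mathbb{R}^d$. Let $\alpha\in(0,1]$. Consider the algorithm BiCoLoR described in the context with compressors satisfying the compressor assumption of the context with constants $\omega,\omega_s,\omega_{\mathrm{av}}$ (where $\omega_{\mathrm{av}}\le\omega$) such that $\omega=\mathcal{O}(1)$ and $\omega_s=\mathcal{O}(1)$ (for instance, quantization), with $\gamma=\frac1L$, $$\rho=\rho_y=\frac{1}{2+\omega_{\mathrm{av}}+2\omega_s},\qquad \eta=\eta_y=\frac{1}{(1+2\omega+2\omega_s)(2+\omega_{\mathrm{av}}+2\omega_s)},$$ $$k=\left\lceil\frac{d}{\sqrt\kappa}\right\rceil,\qquad p_t\equiv p=\min\left(\frac{d}{k\sqrt{\eta\kappa}},1\right).$$ Then the TotalCom complexity (defined in the context) of BiCoLoR to reach $\mathbb{E}[\Psi^t]\le\epsilon$ is $$\mathcal{O}\left(d\sqrt\kappa\,\log\frac{\Psi^0}{\epsilon}\right).$$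
   Context: Norms are Euclidean; $[d]:=\{1,\dots,d\}$. A differentiable function is $L$-smooth if its gradient is $L$-Lipschitz; $\phi$ is $\mu$-strongly convex if $\phi-\frac\mu2\|\cdot\|^2$ is convex. Compressors. For $\omega\ge0$, $\mathbb{U}(\omega)$ is the set of random maps $\mathcal{C}:\mathbb{R}^d\to\mathbb{R}^d$ with $\mathbb{E}[\mathcal{C}(x)]=x$ and $\mathbb{E}\|\mathcal{C}(x)-x\|^2\le\omega\|x\|^2$ for every $x\in\mathbb{R}^d$. For $x\in\mathbb{R}^d$ and $\Omega\subset[d]$, $x_\Omega\in\mathbb{R}^d$ is $x$ with the coordinates outside $\Omega$ set to zero. $\mathcal{C}_\Omega$ denotes the compressor $\mathcal{C}$ applied only to the coordinates in $\Omega$: it maps vectors supported in $\Omega$ to random vectors supported in $\Omega$, with the same unbiasedness and variance bounds (with the same constants) on such vectors. Compressor assumption. For every $t\ge0$ and $i\in[n]$: $\mathcal{C}_i^t\in\mathbb{U}(\omega)$ and $\mathcal{C}_s^t\in\mathbb{U}(\omega_s)$. The families $(\mathcal{C}_1^t,\dots,\mathcal{C}_n^t,\mathcal{C}_s^t)$ are independent for different $t$, and independent of all coin flips and subset choices below. For each $t$, $\mathcal{C}_s^t$ is independent of $(\mathcal{C}_i^t)_{i=1}^n$. The $(\mathcal{C}_i^t)_{i=1}^n$ need not be mutually independent; $\omega_{\mathrm{av}}\ge0$ is a constant such that for every $t$ and every $(x_i)_{i=1}^n\in(\mathbb{R}^d)^n$, $$\mathbb{E}\left\|\frac1n\sum_{i=1}^n(\mathcal{C}_i^t(x_i)-x_i)\right\|^2\le\frac{\omega_{\mathrm{av}}}{n}\sum_{i=1}^n\|x_i\|^2$$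 (and likewise for the restricted compressors on vectors supported in $\Omega$). One can always take $\omega_{\mathrm{av}}\le\omega$. Algorithm BiCoLoR. Parameters: $\gamma,\eta,\eta_y,\rho,\rho_y>0$, probabilities $(p_t)_{t\ge1}$ in $(0,1]$, $k\in[d]$. Deterministic initialization: $x_1^0,\dots,x_n^0,x_s^0,y^0\in\mathbb{R}^d$ arbitrary, and $u_1^0,\dots,u_n^0,u_s^0,u_y^0\in\mathbb{R}^d$ with $\frac1n\sum_{i=1}^nu_i^0+2u_s^0+u_y^0=0$. For $t=0,1,\dots$: 1. $\hat x_i^t:=x_i^t-\gamma\nabla f_i(x_i^t)+\gamma u_i^t$ for $i\in\{1,\dots,n,s\}$, and $\hat y^t:=y^t-\gamma\nabla g(y^t)+\gamma u_y^t$. 2. Draw $\theta^t\in\{0,1\}$ with $\mathrm{Prob}(\theta^t=1)=p_{t+1}$ (independently of everything else). 3. If $\theta^t=1$ (a communication round): draw $\Omega^t\subset[d]$ of size $k$ uniformly at random (independently). Set $c_i^t:=\mathcal{C}^t_{i,\Omega^t}(\hat x^t_{i,\Omega^t}-\hat y^t_{\Omega^t})$ for $i\in[n]$ (sent by client $i$ to the server, uplink), $c_s^t:=\mathcal{C}^t_{s,\Omega^t}(\hat x^t_{s,\Omega^t}-\hat y^t_{\Omega^t})$ (sent by the server to all clients, downlink), $\bar c^t:=\frac1n\sum_{i=1}^nc_i^t$. On the coordinates in $\Omega^t$, for $i\in[n]$, $$x^{t+1}_{i,\Omega^t}:=(1-\rho)\hat x^t_{i,\Omega^t}+\rho(c_s^t+\hat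 y^t_{\Omega^t}),\qquad x^{t+1}_{s,\Omega^t}:=\Big(1-\tfrac{\rho+\rho_y}{2}\Big)\hat x^t_{s,\Omega^t}+\tfrac{\rho+\rho_y}{2}\hat y^t_{\Omega^t}+\tfrac\rho2\bar c^t,$$ while on the coordinates outside $\Omega^t$, $x_i^{t+1}$ and $x_s^{t+1}$ coincide with $\hat x_i^t$ and $\hat x_s^t$. Moreover $y^{t+1}:=\hat y^t+\rho_yc_s^t$, and $$u_i^{t+1}:=u_i^t-\tfrac{p_{t+1}k\eta}{d\gamma}(c_i^t-c_s^t)\ (i\in[n]),\quad u_y^{t+1}:=u_y^t+\tfrac{p_{t+1}k\eta_y}{d\gamma}c_s^t,\quad u_s^{t+1}:=u_s^t+\tfrac{p_{t+1}k\eta}{2d\gamma}\bar c^t-\tfrac{p_{t+1}k(\eta_y+\eta)}{2d\gamma}c_s^t.$$ 4. If $\theta^t=0$: $x_i^{t+1}:=\hat x_i^t$, $u_i^{t+1}:=u_i^t$ for $i\in\{1,\dots,n,s\}$, $y^{t+1}:=\hat y^t$, $u_y^{t+1}:=u_y^t$. Lyapunov function. With $u_y^\star:=\nabla g(x^\star)$, $u_i^\star:=\nabla f_i(x^\star)$, $$\Psi^t:=\frac1\gamma\left(\sum_{i=1}^n\|x_i^t-x^\star\|^2+2n\|x_s^t-x^\star\|^2+n\|y^t-x^\star\|^2\right)+\frac{d^2\gamma}{p^2k^2\eta}\left(\sum_{i=1}^n\|u_i^t-u_i^\star\|^2+n\|u_y^t-u_y^\star\|^2\right).$$ TotalCom complexity.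 Let $T(\epsilon)$ be the smallest integer such that $\mathbb{E}[\Psi^t]\le\epsilon$ for all $t\ge T(\epsilon)$ (iteration complexity). The number of communication rounds is counted in expectation as $p\,T(\epsilon)$. If the compressed vectors $c_i^t$ and $c_s^t$ are encoded on $b$ and $b_s$ bits respectively, the cost of a round is $b+\alpha b_s$ (uplink cost plus $\alpha$ times downlink cost), and the TotalCom complexity is $(b+\alpha b_s)\,p\,T(\epsilon)$. Here the communicated vectors have at most $k$ nonzero entries, at positions known to the receivers, and each real number is represented on at most a fixed number of bits, so $b=\mathcal{O}(k)$ and $b_s=\mathcal{O}(k)$. The $\mathcal{O}$ notation in the conclusion hides constants depending only on the bounds on $\omega,\omega_s$ and on the number of bits per real number (not on $n,d,\alpha,L,\mu,\epsilon$, the functions or the initialization), for accuracies such as $0<\epsilon\le\Psi^0/2$. *)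

(* Defs.v *)
From HB Require Import structures.
From mathcomp Require Import all_boot all_order all_algebra.
From mathcomp Require Import finmap.
From mathcomp Require Import all_classical all_reals all_analysis.

Set Implicit Arguments.
Unset Strict Implicit.
Unset Printing Implicit Defensive.

Import Order.TTheory GRing.Theory Num.Theory numFieldNormedType.Exports.

Local Open Scope classical_set_scope.
Local Open Scope ring_scope.

Section Euclidean.
Variables (R : realType) (d : nat).
Implicit Types (x y v : 'rV[R]_d) (f : 'rV[R]_d -> R) (A : {set 'I_d}).

(* The library norm on 'rV[R]_d is the sup norm, hence this definition.  The
   two are equivalent, so [differentiable] below is the usual notion. *)
Definition enorm v : R := Num.sqrt (\sum_(j < d) v 0 j ^+ 2).

Definition gradient f x : 'rV[R]_d := \row_j 'D_(delta_mx 0 j) f x.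

Definition smooth (L : R) f :=
  (forall x, differentiable f x) /\
  (forall x y, enorm (gradient f x - gradient f y) <= L * enorm (x - y)).

Definition strongly_convex (mu : R) f :=
  convex_function [set: convex_lmodType 'rV[R]_d]
    (fun x : 'rV[R]_d => f x - mu / 2 * enorm x ^+ 2 : R^o).

Definition restrict A v : 'rV[R]_d := \row_j (if j \in A then v 0 j else 0).

Definition supported A v := forall j, j \notin A -> v 0 j = 0.

End Euclidean.

Section Independence.
Local Open Scope ereal_scope.

Definition independent_family (dT : measure_display) (T : measurableType dT)
    (R : realType) (P : probability T R) (I : choiceType)
    (F : I -> set (set T)) :=
  (forall i, F i `<=` measurable) /\
  (forall (J : {fset I}) (A : I -> set T), (forall i, i \in J -> F i (A i)) ->
     P (\bigcap_(i in [set` J]) A i) = \prod_(i <- J) P (A i)).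

End Independence.

Section Compressors.
Context (R : realType) (dT : measure_display) (T : measurableType dT)
  (P : probability T R) (d : nat).

(* A random map is C (xi w) : R^d -> R^d, with xi a random seed and C jointly
   measurable; R^d carries its Borel sigma-algebra through d.-tuple R. *)
Definition jointly_measurable (dU : measure_display) (U : measurableType dU)
    (C : U -> 'rV[R]_d -> 'rV[R]_d) :=
  forall j, measurable_fun [set: U * d.-tuple R]
    (fun q : U * d.-tuple R => C q.1 (\row_i tnth q.2 i) 0 j).

(* Compressor acting on the coordinates in A; for A = [set: 'I_d] this is
   membership in the class U(omega). *)
Definition unbiased_compressor (dU : measure_display) (U : measurableType dU)
    (omega : R) (A : {set 'I_d}) (xi : T -> U)
    (C : U -> 'rV[R]_d -> 'rV[R]_d) :=
  jointly_measurable C /\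
  forall x, supported A x ->
    [/\ forall z, supported A (C z x),
        forall j, ('E_P[fun w => C (xi w) x 0%R j] = (x 0%R j)%:E)%E
      & ('E_P[fun w => (enorm (C (xi w) x - x) ^+ 2)%R]
           <= (omega * enorm x ^+ 2)%:E)%E].

(* C t i A is the client compressor C_i^t restricted to the coordinates in A
   (C_i^t itself is C t i [set: 'I_d]), and Cs t A is the server one.  The n
   client compressors of iteration t share the seed xi t, so that they may be
   arbitrarily dependent; the server compressor has its own seed zeta t. *)
Definition compressor_bounds (dU dV : measure_display)
    (U : measurableType dU) (V : measurableType dV) (n : nat)
    (omega omega_s omega_av : R)
    (xi : nat -> T -> U) (zeta : nat -> T -> V)
    (C : nat -> 'I_n -> {set 'I_d} -> U -> 'rV[R]_d -> 'rV[R]_d)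
    (Cs : nat -> {set 'I_d} -> V -> 'rV[R]_d -> 'rV[R]_d) :=
  [/\ forall t i A, unbiased_compressor omega A (xi t) (C t i A),
      forall t A, unbiased_compressor omega_s A (zeta t) (Cs t A)
    & forall t (A : {set 'I_d}) (x : 'I_n -> 'rV[R]_d),
        (forall i, supported A (x i)) ->
        ('E_P[fun w => (enorm (n%:R^-1 *:
             \sum_(i < n) (C t i A (xi t w) (x i) - x i)) ^+ 2)%R]
          <= (omega_av / n%:R * \sum_(i < n) enorm (x i) ^+ 2)%:E)%E].

(* Events determined by one of the independent sources: the coin theta t, the
   subset S t, the client seed xi t, the server seed zeta t. *)
Definition source_events (dU dV : measure_display)
    (U : measurableType dU) (V : measurableType dV)
    (theta : nat -> T -> bool) (S : nat -> T -> {set 'I_d})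
    (xi : nat -> T -> U) (zeta : nat -> T -> V)
    (i : (nat + nat) + (nat + nat)) : set (set T) :=
  match i with
  | inl (inl t) => preimage_set_system setT (theta t) setT
  | inl (inr t) => preimage_set_system setT (S t) setT
  | inr (inl t) => preimage_set_system setT (xi t) measurable
  | inr (inr t) => preimage_set_system setT (zeta t) measurable
  end.

(* Drawing S t also when theta t = false is harmless: it is then not used. *)
Definition random_sources (dU dV : measure_display)
    (U : measurableType dU) (V : measurableType dV) (p : nat -> R) (k : nat)
    (theta : nat -> T -> bool) (S : nat -> T -> {set 'I_d})
    (xi : nat -> T -> U) (zeta : nat -> T -> V) :=
  [/\ independent_family P (source_events theta S xi zeta),
      forall t, P (theta t @^-1` [set true]) = (p t.+1)%:E
    & forall t (A : {set 'I_d}), #|A| = k ->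
        P (S t @^-1` [set A]) = ('C(d, k)%:R^-1)%:E].

End Compressors.

Record parameters (R : realType) := MkParameters {
  gamma : R; eta : R; eta_y : R; rho : R; rho_y : R;
  prob : nat -> R; (* only the values at t >= 1 are used *)
  ksize : nat }.

Record state (R : realType) (n d : nat) := State {
  x_cl : 'I_n -> 'rV[R]_d; x_srv : 'rV[R]_d; y_aux : 'rV[R]_d;
  u_cl : 'I_n -> 'rV[R]_d; u_srv : 'rV[R]_d; u_y : 'rV[R]_d }.

Section BiCoLoR.
Variables (R : realType) (n d : nat).
Variables (f : 'I_n -> 'rV[R]_d -> R) (fs g : 'rV[R]_d -> R).

(* One iteration, given the realizations th of the coin, A of the subset and
   C, Cs of the (restricted) compressors. *)
Definition bicolor_step (q : parameters R) (t : nat) (th : bool)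
    (A : {set 'I_d}) (C : 'I_n -> {set 'I_d} -> 'rV[R]_d -> 'rV[R]_d)
    (Cs : {set 'I_d} -> 'rV[R]_d -> 'rV[R]_d) (s : state R n d) :
    state R n d :=
  let xh i := x_cl s i - gamma q *: gradient (f i) (x_cl s i)
              + gamma q *: u_cl s i in
  let xsh := x_srv s - gamma q *: gradient fs (x_srv s)
             + gamma q *: u_srv s in
  let yh := y_aux s - gamma q *: gradient g (y_aux s) + gamma q *: u_y s in
  if th then
    let c i := C i A (restrict A (xh i) - restrict A yh) in
    let cs := Cs A (restrict A xsh - restrict A yh) in
    let cbar := n%:R^-1 *: \sum_(i < n) c i in
    let r := prob q t.+1 * (ksize q)%:R / (d%:R * gamma q) in
    State
      (fun i => restrict (~: A) (xh i)
         + ((1 - rho q) *: restrict A (xh i)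
            + rho q *: (cs + restrict A yh)))
      (restrict (~: A) xsh
         + ((1 - (rho q + rho_y q) / 2) *: restrict A xsh
            + ((rho q + rho_y q) / 2) *: restrict A yh
            + (rho q / 2) *: cbar))
      (yh + rho_y q *: cs)
      (fun i => u_cl s i - (r * eta q) *: (c i - cs))
      (u_srv s + (r * eta q / 2) *: cbar
         - (r * (eta_y q + eta q) / 2) *: cs)
      (u_y s + (r * eta_y q) *: cs)
  else State xh xsh yh (u_cl s) (u_srv s) (u_y s).

Fixpoint bicolor (T U V : Type) (q : parameters R)
    (theta : nat -> T -> bool) (S : nat -> T -> {set 'I_d})
    (xi : nat -> T -> U) (zeta : nat -> T -> V)
    (C : nat -> 'I_n -> {set 'I_d} -> U -> 'rV[R]_d -> 'rV[R]_d)
    (Cs : nat -> {set 'I_d} -> V -> 'rV[R]_d -> 'rV[R]_d)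
    (s0 : state R n d) (t : nat) (w : T) : state R n d :=
  if t is t'.+1 then
    bicolor_step q t' (theta t' w) (S t' w)
      (fun i A => C t' i A (xi t' w)) (fun A => Cs t' A (zeta t' w))
      (bicolor q theta S xi zeta C Cs s0 t' w)
  else s0.

(* For a constant probability p. *)
Definition lyapunov (q : parameters R) (p : R) (xstar : 'rV[R]_d)
    (s : state R n d) : R :=
  (gamma q)^-1 * (\sum_(i < n) enorm (x_cl s i - xstar) ^+ 2
                  + 2 * n%:R * enorm (x_srv s - xstar) ^+ 2
                  + n%:R * enorm (y_aux s - xstar) ^+ 2)
  + d%:R ^+ 2 * gamma q / (p ^+ 2 * (ksize q)%:R ^+ 2 * eta q)
    * (\sum_(i < n) enorm (u_cl s i - gradient (f i) xstar) ^+ 2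
       + n%:R * enorm (u_y s - gradient g xstar) ^+ 2).

Definition objective (x : 'rV[R]_d) : R :=
  n%:R^-1 * (\sum_(i < n) f i x) + 2 * fs x + g x.

End BiCoLoR.

Definition is_iteration_complexity (R : realType) (dT : measure_display)
    (T : measurableType dT) (P : probability T R) (Psi : nat -> T -> R)
    (eps : R) (N : nat) :=
  let reached M := forall t, (M <= t)%N -> ('E_P[Psi t] <= eps%:E)%E in
  reached N /\ forall M, reached M -> (N <= M)%N.

Definition total_com (R : realType) (alpha : R) (b bs : nat) (p : R)
    (N : nat) : R :=
  (b%:R + alpha * bs%:R) * p * N%:R.

(* Main.v *)
(* Put a_i, a_s, a_y for the errors of the local gradient steps and v_i, v_s, v_y
   for those of the control variates. A communication round is a gossip step on
   the star graph centred at the server, perturbed by centred compression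
   errors. With D = sum_i |a_i - a_s|^2 + n |a_y - a_s|^2 restricted to the
   coordinates drawn, the primal part of Psi decreases on average by a multiple
   of rho * D, which is exactly what the dual part pays for the squares, so only
   the cross term - 2 sum_i <v_i, a_i - a_s> - 2 n <v_y, a_y - a_s> remains.
   Averaged over the coin and the subset, and since the v are balanced
   (sum_i v_i + 2 n v_s + n v_y = 0), it completes the squares in
   a = w + gamma * v, where w are the plain gradient step errors, contracted by
   1 - mu / L through cocoercivity. Hence E Psi^(t+1) <= (1 - eta / kappa) E Psi^t,
   so T(eps) = O(kappa log (Psi^0 / eps)), while a round costs O(k) bits and
   k * p <= d / sqrt (eta * kappa). *)
Require Import Defs.
From HB Require Import structures.
From mathcomp Require Import all_boot all_order all_algebra.
From mathcomp Require Import finmap.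
From mathcomp Require Import all_classical all_reals all_analysis.
From mathcomp Require Import measurable_realfun.
From mathcomp Require Import ring lra.

Set Implicit Arguments.
Unset Strict Implicit.
Unset Printing Implicit Defensive.

Import Order.TTheory GRing.Theory Num.Theory numFieldNormedType.Exports.

Local Open Scope classical_set_scope.
Local Open Scope ring_scope.

(** * Smooth and strongly convex functions *)

Section ConvexAnalysis.
Variables (R : realType) (d : nat).
Implicit Types (x y z v : 'rV[R]_d) (f : 'rV[R]_d -> R).

(** The probabilistic obstacle is that the iterate at time [t] has to be frozen while the sources of
    time [t] are averaged. Instead of conditional expectations, independence is turned into a
    product law of past, client seed and server seed on each event that fixes the coin and the
    subset, and the average becomes an iterated integral. Its order matters: after a round Psi
    contains products of client and server errors. For a fixed client seed they are linear in the
    server error, which is centred, so the server seed is integrated innermost. The client errors,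
    possibly dependent, then enter only linearly and through their squares and the square of their
    average. Psi is a sum over coordinates, hence the algebra is scalar; the variance bounds, which
    couple the coordinates, apply to total squared norms. The dual weight [c] and the dual step [re]
    satisfy [c * re ^+ 2 = eta / gamma] and [p * (k / d) * (c * re) = 1]: the first puts the dual
    squares on the scale of the primal ones, the second gives the averaged cross term the exact
    coefficient 2 of a completed square. *)

Definition dot x y : R := \sum_(j < d) x 0 j * y 0 j.

Lemma dotC x y : dot x y = dot y x.
Proof. by apply: eq_bigr => j _; rewrite mulrC. Qed.

Lemma dotDl x y z : dot (x + y) z = dot x z + dot y z.
Proof. by rewrite -big_split; apply: eq_bigr => j _; rewrite mxE mulrDl. Qed.

Lemma dotZl (a : R) x y : dot (a *: x) y = a * dot x y.
Proof. by rewrite mulr_sumr; apply: eq_bigr => j _; rewrite mxE mulrA. Qed.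

Lemma dotNl x y : dot (- x) y = - dot x y.
Proof. by rewrite -scaleN1r dotZl mulN1r. Qed.

Lemma dotDr x y z : dot z (x + y) = dot z x + dot z y.
Proof. by rewrite !(dotC z) dotDl. Qed.

Lemma dotZr (a : R) x y : dot y (a *: x) = a * dot y x.
Proof. by rewrite !(dotC y) dotZl. Qed.

Lemma dotNr x y : dot y (- x) = - dot y x.
Proof. by rewrite !(dotC y) dotNl. Qed.

Lemma dot_suml n (F : 'I_n -> 'rV[R]_d) x :
  dot (\sum_i F i) x = \sum_i dot (F i) x.
Proof.
rewrite /dot exchange_big; apply: eq_bigr => j _.
by rewrite summxE mulr_suml.
Qed.

Lemma dot_ge0 x : 0 <= dot x x.
Proof. by apply: sumr_ge0 => j _; rewrite -expr2 sqr_ge0. Qed.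

Lemma enorm_sqr x : enorm x ^+ 2 = dot x x.
Proof.
rewrite sqr_sqrtr; last by apply: sumr_ge0 => j _; rewrite sqr_ge0.
by apply: eq_bigr => j _; rewrite expr2.
Qed.

Lemma enorm_ge0 x : 0 <= enorm x.
Proof. exact: sqrtr_ge0. Qed.

Lemma dot_eq0 x : dot x x = 0 -> x = 0.
Proof.
move=> x0; apply/rowP => j; rewrite mxE.
have /psumr_eq0P h := x0.
apply/eqP; rewrite -sqrf_eq0 expr2; apply/eqP.
by apply: h => // i _; rewrite -expr2 sqr_ge0.
Qed.

Lemma derive_dot f x v : differentiable f x -> 'D_v f x = dot (gradient f x) v.
Proof.
move=> df; rewrite deriveE//.
rewrite {1}(row_sum_delta v) linear_sum; apply: eq_bigr => j _.
by rewrite linearZ /= !mxE deriveE// mulrC.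
Qed.

Lemma is_derive_line f x v (t : R) : differentiable f (x + t *: v) ->
  is_derive t 1 (fun s => f (x + s *: v)) (dot (gradient f (x + t *: v)) v).
Proof.
move=> df.
have dl : is_diff t (fun s : R => x + s *: v) (fun s => s *: v).
  have -> : (fun s : R => s *: v) = 0 + *:%R ^~ v.
    by apply/funext => s; rewrite fctE /= add0r.
  exact: (is_diffD (is_diff_cst x t) (is_diff_scalel t v)).
have dc : is_diff t (f \o (fun s => x + s *: v))
    ('d f (x + t *: v) \o (fun s => s *: v)).
  by apply: is_diff_comp; exact: differentiableP.
apply: DeriveDef.
  by apply: diff_derivable; exact: ex_diff.
rewrite deriveE; last exact: ex_diff.
by rewrite (diff_val (is_diff_def := dc)) /= scale1r -derive_dot// deriveE.
Qed.

(* The sign [s] makes one proof serve for the upper and the lower quadratic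
   bound. *)
Lemma descent (L s : R) f x v : s ^+ 2 = 1 -> smooth L f ->
  s * (f (x + v) - f x - dot (gradient f x) v) <= L / 2 * dot v v.
Proof.
move=> s1 [df Lf].
(* The claim is [h 1 <= h 0]; by the mean value theorem it is enough that the derivative [dh] is
   nonpositive on the open interval. *)
pose h (t : R) := s * f (x + t *: v) - t * (s * dot (gradient f x) v)
  - t ^+ 2 * (L / 2 * dot v v).
pose dh (t : R) := s * dot (gradient f (x + t *: v)) v
  - s * dot (gradient f x) v - t * (L * dot v v).
have hd (t : R) : is_derive t 1 h (dh t).
  have := is_derive_line (df (x + t *: v)) => d1.
  rewrite /h; apply: is_derive_eq.
  rewrite /dh; set G := dot (gradient f (x + _)) v; rewrite /GRing.scale /=.
  by field.
have hc : {within `[0, 1], continuous h}.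
  apply: continuous_subspaceT => t; apply: differentiable_continuous.
  by apply/derivable1_diffP; have [] := hd t.
have [t] := MVT (@ltr01 R) (fun t _ => hd t) hc.
rewrite in_itv /= => /andP[t0 t1].
suff dh0 : dh t <= 0.
  move=> E; move: dh0; have : dh t = h 1 - h 0 by rewrite E subr0 mulr1.
  move=> ->; rewrite /h scale0r addr0 scale1r expr1n expr0n /= => h0.
  by lra.
have := Lf (x + t *: v) x.
have -> : x + t *: v - x = t *: v by rewrite addrAC subrr add0r.
set G := _ - _ => LG.
have L0 : 0 <= L * enorm (t *: v) by apply: le_trans LG; exact: enorm_ge0.
have {}LG : dot G G <= (L * t) ^+ 2 * dot v v.
  rewrite -enorm_sqr.
  apply: (@le_trans _ _ ((L * enorm (t *: v)) ^+ 2)).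
    by rewrite ler_pXn2r// nnegrE// enorm_ge0.
  by rewrite exprMn enorm_sqr dotZl dotZr exprMn; lra.
have -> : dh t = s * dot G v - t * (L * dot v v).
  by rewrite /dh /G dotDl dotNl; ring.
clearbody G.
have [v0|v0] := eqVneq (dot v v) 0.
  rewrite (dot_eq0 v0) -(scale0r (0 : 'rV[R]_d)) !dotZr !mul0r; lra.
have vp : 0 < dot v v by rewrite lt_neqAle eq_sym v0 dot_ge0.
have Lp : 0 <= L.
  move: L0; rewrite pmulr_lge0// lt_neqAle enorm_ge0 andbT eq_sym.
  rewrite -sqrf_eq0 enorm_sqr dotZl dotZr !mulf_eq0 negb_or (gt_eqF t0) /=.
  by rewrite (negbTE v0).
have [L00|L00] := eqVneq L 0.
  have G0 : dot G G = 0.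
    apply/eqP; rewrite eq_le dot_ge0 andbT; move: LG.
    by rewrite L00 mul0r expr0n mul0r.
  rewrite (dot_eq0 G0) L00 mul0r mulr0 subr0 /dot big1 ?mulr0//.
  by move=> j _; rewrite mxE mul0r.
have Ltp : 0 < L * t by rewrite mulr_gt0// lt_neqAle eq_sym L00.
(* Cauchy-Schwarz by expanding a square: with [dot G G <= (L * t) ^+ 2 * dot v v] it bounds
   [s * dot G v] by [L * t * dot v v] after division by [L * t], which is why [v = 0] and [L = 0]
   were split off. *)
have := dot_ge0 (s *: G - (L * t) *: v).
rewrite !(dotDl, dotDr, dotNl, dotNr, dotZl, dotZr) (dotC v G).
rewrite !mulrA -[s * s]expr2 s1 mul1r => H.
have : 0 <= (L * t) * (2 * (L * t * dot v v - s * dot G v)).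
  by nra.
by rewrite pmulr_rge0// => ?; lra.
Qed.

(** Convexity on the segment is compared with the lower quadratic bound [descent] ([s = -1]) at
    [x + t *: v]. After division by [t] the desired inequality holds up to an error linear in [t],
    which small [t] removes. *)
Lemma strongly_convex_lower (mu L : R) f x y : 0 <= mu ->
  smooth L f -> strongly_convex mu f ->
  f x + dot (gradient f x) (y - x) + mu / 2 * dot (y - x) (y - x) <= f y.
Proof.
move=> mu0 sf cf.
rewrite -[X in _ <= f X](subrKC x); move: (y - x) => {y} v.
have key (t : R) : 0 < t <= 1 ->
    f x + dot (gradient f x) v + mu / 2 * dot v v
      <= f (x + v) + t * ((L + mu) / 2 * dot v v).
  move=> /andP[t0 t1].
  have : f (t *: (x + v) + (1 - t) *: x) - mu / 2 * enorm (t *: (x + v) + (1 - t) *: x) ^+ 2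
      <= t * (f (x + v) - mu / 2 * enorm (x + v) ^+ 2)
         + (1 - t) * (f x - mu / 2 * enorm x ^+ 2).
    exact: cf (Itv01 (ltW t0) t1) (x + v) x (mem_set I) (mem_set I).
  have -> : t *: (x + v) + (1 - t) *: x = x + t *: v.
    rewrite scalerDr scalerBl scale1r [_ + t *: v]addrC addrACA subrr addr0.
    by rewrite addrC.
  rewrite !enorm_sqr.
  rewrite !(dotDl, dotDr, dotZl, dotZr) (dotC v x) => H1.
  have := @descent L (-1) f x (t *: v) _ sf.
  rewrite sqrrN expr1n => /(_ erefl).
  rewrite !(dotDl, dotDr, dotZl, dotZr) => H2.
  rewrite -(ler_pM2l t0).
  set a := dot v v in H1 H2 *; set bb := dot (gradient f x) v in H2 *.
  set c1 := dot x v in H1; set c2 := dot x x in H1.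
  by nra.
have M0 : 0 <= dot v v by exact: dot_ge0.
rewrite leNgt; apply/negP => lt.
pose K := (L + mu) / 2 * dot v v.
have := key 1; rewrite ltr01 lexx mul1r => /(_ isT) k1.
set A := f x + _ + _ in lt key k1.
have lt0 : 0 < A - f (x + v) by rewrite subr_gt0.
have K0 : 0 < K by rewrite /K; lra.
(* Makes the error [t * K] at most half of the assumed gap [A - f (x + v)], a contradiction. *)
pose t := Num.min 1 ((A - f (x + v)) / (2 * K)).
have tp : 0 < t.
  rewrite lt_min ltr01 andTb. apply: divr_gt0. done. by apply: mulr_gt0.
have := key t; rewrite tp ge_min lexx => /(_ isT).
have : t * K <= (A - f (x + v)) / 2.
  rewrite -ler_pdivlMr// ge_min; apply/orP; right.
  by rewrite invfM mulrA.
by rewrite -/K; lra.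
Qed.

(** The tangent at [a] minorizes [f] at [b + w], the quadratic bound at [b] majorizes it. With [w]
    below, which minimizes the difference of the two bounds, this yields [key], a tangent inequality
    improved by [dot G G / (2 * L)]. Adding it to itself with the points exchanged gives the
    claim. *)
Lemma cocoercive (mu L : R) f x y : 0 <= mu -> 0 < L ->
  smooth L f -> strongly_convex mu f ->
  dot (gradient f x - gradient f y) (gradient f x - gradient f y)
    <= L * dot (gradient f x - gradient f y) (x - y).
Proof.
move=> mu0 L0 sf cf.
have key a b : f a + dot (gradient f a) (b - a) +
    (2 * L)^-1 * dot (gradient f b - gradient f a) (gradient f b - gradient f a)
    <= f b.
  set G := gradient f b - gradient f a.
  pose w := - (L^-1 *: G).
  have := @descent L 1 f b w (expr1n _ _) sf.
  have := strongly_convex_lower a (b + w) mu0 sf cf.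
  have := dot_ge0 (b + w - a); set q := dot (b + w - a) _ => q0.
  have : 0 <= mu / 2 * q by rewrite mulr_ge0// divr_ge0.
  have -> : dot (gradient f b) w = dot (gradient f a) w + dot G w.
    by rewrite -dotDl subrKC.
  have -> : b + w - a = (b - a) + w by rewrite addrAC.
  rewrite dotDr /w !(dotNl, dotNr, dotZl, dotZr) opprK.
  rewrite invfM.
  have -> : L / 2 * (L^-1 * (L^-1 * dot G G)) = L^-1 / 2 * dot G G.
    by field; rewrite gt_eqF.
  by lra.
have := lerD (key x y) (key y x).
set G := gradient f x - gradient f y.
have -> : gradient f y - gradient f x = - G by rewrite opprB.
rewrite dotNl dotNr opprK.
have -> : y - x = - (x - y) by rewrite opprB.
rewrite dotNr.
have -> : dot (gradient f x) (x - y) = dot (gradient f y) (x - y) + dot G (x - y).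
  by rewrite -dotDl subrKC.
move=> H.
have : L^-1 * dot G G <= dot G (x - y) by rewrite invfM in H; lra.
by rewrite ler_pdivrMl.
Qed.

Lemma strongly_monotone (mu L : R) f x y : 0 <= mu ->
  smooth L f -> strongly_convex mu f ->
  mu * dot (x - y) (x - y) <= dot (gradient f x - gradient f y) (x - y).
Proof.
move=> mu0 sf cf.
have := lerD (strongly_convex_lower x y mu0 sf cf)
             (strongly_convex_lower y x mu0 sf cf).
have -> : y - x = - (x - y) by rewrite opprB.
by rewrite !(dotNl, dotNr, dotDl (gradient f x)); lra.
Qed.

(** In the expanded square, cocoercivity absorbs the term in [dot G G] into half of the cross term;
    strong monotonicity turns the other half into the factor [mu / L]. *)
Lemma gradient_step_contraction (mu L : R) f x y : 0 <= mu -> 0 < L ->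
  smooth L f -> strongly_convex mu f ->
  enorm ((x - L^-1 *: gradient f x) - (y - L^-1 *: gradient f y)) ^+ 2
    <= (1 - mu / L) * enorm (x - y) ^+ 2.
Proof.
move=> mu0 L0 sf cf; rewrite !enorm_sqr.
have := cocoercive x y mu0 L0 sf cf.
have := strongly_monotone x y mu0 sf cf.
set G := gradient f x - gradient f y.
have -> : x - L^-1 *: gradient f x - (y - L^-1 *: gradient f y)
    = (x - y) - L^-1 *: G.
  by apply/rowP => j; rewrite !mxE; ring.
set z := x - y; clearbody z G.
rewrite !(dotDl, dotDr, dotNl, dotNr, dotZl, dotZr) (dotC z G) opprK.
rewrite -(ler_pM2l (_ : 0 < L^-1)) ?invr_gt0// => H1.
rewrite -(ler_pM2l (_ : 0 < L^-1 * L^-1)) ?mulr_gt0 ?invr_gt0//.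
have -> : L^-1 / L * (L * dot G z) = L^-1 * dot G z by field; rewrite gt_eqF.
by lra.
Qed.

(** The upper quadratic bounds of all terms add up to [0 <= dot G v + K * dot v v] for every [v];
    the minimizing [v] then forces [G = 0]. *)
Lemma minimizer_gradient n (L : R) (F : 'I_n -> 'rV[R]_d -> R)
    (fs g : 'rV[R]_d -> R) x : 0 < L ->
  (forall i, smooth L (F i)) -> smooth L fs -> smooth L g ->
  (forall y, objective F fs g x <= objective F fs g y) ->
  n%:R^-1 *: (\sum_i gradient (F i) x) + 2 *: gradient fs x + gradient g x = 0.
Proof.
move=> L0 sF sfs sg xmin; set G := _ + _ + _.
(* Total smoothness: [n%:R^-1 * n%:R] from the client average, 2 from [fs] and 1 from [g]. The first
   product is left unsimplified so that [n = 0] is covered. *)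
pose K := (n%:R^-1 * n%:R + 3) * (L / 2).
have K0 : 0 < K.
  by rewrite mulr_gt0 ?divr_gt0// ltr_wpDl// mulr_ge0// invr_ge0.
have up v : 0 <= dot G v + K * dot v v.
  have := xmin (x + v); rewrite /objective.
  have D h (sh : smooth L h) := @descent L 1 h x v (expr1n _ _) sh.
  have : n%:R^-1 * \sum_i F i (x + v) <=
      n%:R^-1 * (\sum_i F i x + \sum_i dot (gradient (F i) x) v
                 + n%:R * (L / 2 * dot v v)).
    rewrite ler_wpM2l ?invr_ge0//.
    have -> : n%:R * (L / 2 * dot v v) = \sum_(i < n) (L / 2 * dot v v).
      by rewrite sumr_const card_ord mulr_natl.
    rewrite -!big_split /=; apply: ler_sum => i _.
    by have := D _ (sF i); lra.
  have := D _ sfs; have := D _ sg.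
  rewrite /G !dotDl !dotZl dot_suml /K; lra.
have := up (- ((2 * K)^-1 *: G)).
rewrite !(dotNl, dotNr, dotZl, dotZr) opprK invfM.
have -> : K * (2^-1 / K * (2^-1 / K * dot G G)) = K^-1 / 4 * dot G G.
  by field; rewrite gt_eqF.
have Ki : 0 < K^-1 by rewrite invr_gt0.
move=> H; have H2 : K^-1 * dot G G <= 0 by lra.
apply: dot_eq0; apply/eqP; rewrite eq_le dot_ge0 andbT.
by rewrite -(pmulr_rle0 _ Ki).
Qed.

End ConvexAnalysis.

(** * Measurability of the iterates *)

Section Measurability.
Variables (R : realType) (d : nat) (dX : measure_display)
  (X : measurableType dX).

(** Lets the coin and the subset be treated as constants: a function is measurable once it is so on
    each fiber of a finite-valued variable. *)
Lemma measurable_fun_finite (I : finType) d' (Y : measurableType d')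
    (h : X -> I) (F : I -> X -> Y) :
  (forall i, measurable (h @^-1` [set i])) ->
  (forall i, measurable_fun setT (F i)) ->
  measurable_fun setT (fun w => F (h w) w).
Proof.
move=> mh mF _ Q mQ; rewrite setTI.
have -> : (fun w => F (h w) w) @^-1` Q =
    \big[setU/set0]_(i : I) (h @^-1` [set i] `&` F i @^-1` Q).
  apply/seteqP; split => w /=.
    by move=> Qw; rewrite -bigcup_seq; exists (h w) => //=; rewrite mem_index_enum.
  by rewrite -bigcup_seq => -[i _ [/= <-]].
apply: bigsetU_measurable => i _; apply: measurableI => //.
by rewrite -[X in measurable X]setTI; exact: mF.
Qed.

(** Coordinatewise, to match [jointly_measurable], where vectors are read through [d.-tuple R]. *)
Definition measurable_vec (v : X -> 'rV[R]_d) :=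
  forall j, measurable_fun setT (fun w => v w 0 j).

Lemma measurable_vec_cst v : measurable_vec (fun=> v).
Proof. by move=> j; exact: measurable_cst. Qed.

Lemma measurable_vecD v1 v2 : measurable_vec v1 -> measurable_vec v2 ->
  measurable_vec (fun w => v1 w + v2 w).
Proof.
move=> m1 m2 j; under eq_fun do rewrite mxE.
exact: measurable_funD.
Qed.

Lemma measurable_vecZ (a : R) v : measurable_vec v ->
  measurable_vec (fun w => a *: v w).
Proof.
move=> m j; under eq_fun do rewrite mxE.
exact: measurable_funM.
Qed.

Lemma measurable_vecN v : measurable_vec v -> measurable_vec (fun w => - v w).
Proof.
by move=> m; under eq_fun do rewrite -scaleN1r; exact: measurable_vecZ.
Qed.

Lemma measurable_vecB v1 v2 : measurable_vec v1 -> measurable_vec v2 ->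
  measurable_vec (fun w => v1 w - v2 w).
Proof.
by move=> m1 m2; apply: measurable_vecD => //; exact: measurable_vecN.
Qed.

Lemma measurable_vec_sum n (F : 'I_n -> X -> 'rV[R]_d) :
  (forall i, measurable_vec (F i)) ->
  measurable_vec (fun w => \sum_(i < n) F i w).
Proof.
move=> m j; under eq_fun do rewrite summxE.
by apply: measurable_sum => i; exact: m.
Qed.

Lemma measurable_vec_restrict A v : measurable_vec v ->
  measurable_vec (fun w => Defs.restrict A (v w)).
Proof.
move=> m j; have [jA|/negbTE jA] := boolP (j \in A).
  by under eq_fun do rewrite mxE jA; exact: m.
by under eq_fun do rewrite mxE jA; exact: measurable_cst.
Qed.

Lemma measurable_dot v1 v2 : measurable_vec v1 -> measurable_vec v2 ->
  measurable_fun setT (fun w => dot (v1 w) (v2 w)).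
Proof.
move=> m1 m2; apply: measurable_sum => j.
exact: measurable_funM.
Qed.

Lemma measurable_enorm2 v : measurable_vec v ->
  measurable_fun setT (fun w => enorm (v w) ^+ 2).
Proof.
by move=> m; under eq_fun do rewrite enorm_sqr; exact: measurable_dot.
Qed.

Lemma measurable_enorm v : measurable_vec v ->
  measurable_fun setT (fun w => enorm (v w)).
Proof.
move=> m; rewrite /enorm.
apply: (measurableT_comp (f := @Num.sqrt R)) => //.
  apply: continuous_measurable_fun; exact: sqrt_continuous.
by apply: measurable_sum => j; exact: measurable_funX.
Qed.

Lemma enorm_rational_approx (x : 'rV[R]_d) (e : R) : 0 < e ->
  exists q : 'rV[rat]_d, enorm (x - map_mx ratr q) < e.
Proof.
(* The denominator [d.+1] also covers [d = 0] and gives [d%:R * e' ^+ 2 < e ^+ 2]. *)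
move=> e0; pose e' := e / d.+1%:R.
have e'0 : 0 < e' by rewrite divr_gt0.
have /all_sig [q qP] : forall j, {q : rat | `|x 0 j - ratr q| < e'}.
  move=> j; apply: cid.
  have : x 0 j - e' < x 0 j + e' by lra.
  move=> /rat_in_itvoo[q]; rewrite in_itv /= => /andP[q1 q2].
  by exists q; rewrite ltr_norml; apply/andP; split; lra.
exists (\row_j q j).
rewrite -(ltr_pXn2r (ltn0Sn 1)) ?nnegrE ?enorm_ge0 ?(ltW e0)//.
rewrite enorm_sqr /dot.
apply: (@le_lt_trans _ _ (\sum_(j < d) e' ^+ 2)).
  apply: ler_sum => j _; rewrite !mxE -expr2 -real_normK ?num_real//.
  by rewrite ler_pXn2r ?nnegrE// ltW.
rewrite sumr_const card_ord -mulr_natl /e' expr_div_n.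
rewrite mulrCA gtr_pMr ?exprn_gt0// ltr_pdivrMr ?exprn_gt0// mul1r.
by rewrite -natrX ltr_nat -mulnn mulnS ltnS leq_addr.
Qed.

(* A Lipschitz function is the infimum over the rational points [q] of the
   cones [h q + L |x - q|]. *)
Lemma measurable_lipschitz (L : R) (h : 'rV[R]_d -> R) v : 0 <= L ->
  (forall x y, h x - h y <= L * enorm (x - y)) ->
  measurable_vec v -> measurable_fun setT (fun w => h (v w)).
Proof.
move=> L0 hL mv.
pose F (q : 'rV[rat]_d) w : R :=
  h (map_mx ratr q) + L * enorm (v w - map_mx ratr q).
apply: (measurability _ (RGenInftyO.measurableE R)) => _ [_ [a ->] <-].
rewrite setTI.
have -> : (fun w => h (v w)) @^-1` `]-oo, a[%classic =
    \bigcup_n (if choice.unpickle n : option 'rV[rat]_d is Some q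
                then F q @^-1` `]-oo, a[%classic else set0).
  apply/seteqP; split => w /=.
    rewrite in_itv /= => hw.
    (* Moving to a rational [q] at distance [z] raises [h] by at most [L * z], and the cone adds
       [L * z] again: hence the 2. The summand 1 keeps the denominator positive when [L = 0]. *)
    have e0 : 0 < (a - h (v w)) / (2 * (L + 1)).
      by rewrite divr_gt0 ?subr_gt0// mulr_gt0// ltr_wpDl.
    have [q qP] := enorm_rational_approx (v w) e0.
    exists (choice.pickle q) => //; rewrite choice.pickleK /= in_itv /= /F.
    have := hL (map_mx ratr q) (v w).
    have -> : enorm (map_mx ratr q - v w) = enorm (v w - map_mx ratr q).
      rewrite -opprB /enorm; congr Num.sqrt; apply: eq_bigr => j _.
      by rewrite !mxE sqrrN.
    set z := enorm _ in qP *.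
    have L1 : 0 < 2 * (L + 1) by lra.
    move: qP; rewrite ltr_pdivlMr// => qP.
    have : 0 <= z by exact: enorm_ge0.
    by nra.
  move=> [n _]; case: choice.unpickle => // q; rewrite /= !in_itv /= /F => /le_lt_trans; apply.
  by rewrite -lerBlDl.
apply: bigcupT_measurable => n; case: choice.unpickle => // q.
rewrite -[X in measurable X]setTI; apply: (_ : measurable_fun setT (F q)) => //.
apply: measurable_funD => //; apply: measurable_funM => //.
apply: measurable_enorm; apply: measurable_vecB => //; exact: measurable_vec_cst.
Qed.

Lemma coord_le_enorm (x : 'rV[R]_d) j : x 0 j <= enorm x.
Proof.
rewrite (le_trans (ler_norm _))// -(ler_pXn2r (ltn0Sn 1)) ?nnegrE ?enorm_ge0//.
rewrite enorm_sqr real_normK ?num_real// /dot (bigD1 j)//= -expr2 lerDl.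
by apply: sumr_ge0 => i _; rewrite -expr2 sqr_ge0.
Qed.

Lemma measurable_gradient (L : R) (f : 'rV[R]_d -> R) v : 0 <= L -> smooth L f ->
  measurable_vec v -> measurable_vec (fun w => gradient f (v w)).
Proof.
move=> L0 [_ Lf] mv j.
apply: (measurable_lipschitz (h := fun x => gradient f x 0 j) L0) => // x y.
have := coord_le_enorm (gradient f x - gradient f y) j.
by rewrite !mxE => /le_trans; apply.
Qed.

Lemma measurable_compressor d' (U : measurableType d')
    (C : U -> 'rV[R]_d -> 'rV[R]_d) (xi : X -> U) v :
  jointly_measurable C -> measurable_fun setT xi -> measurable_vec v ->
  measurable_vec (fun w => C (xi w) (v w)).
Proof.
move=> mC mxi mv j.
pose tv (w : X) : d.-tuple R := [tuple v w 0 i | i < d].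
have mtv : measurable_fun setT tv.
  apply/measurable_fun_tnthP => i; apply: eq_measurable_fun (mv i) => w _ /=.
  by rewrite tnth_mktuple.
have mp : measurable_fun setT (fun w => (xi w, tv w)).
  exact: measurable_fun_pair.
have := measurableT_comp (mC j) mp.
apply: eq_measurable_fun => w _ /=; congr (C _ _ _ _).
by apply/rowP => i; rewrite mxE tnth_mktuple.
Qed.

End Measurability.

(** * Measurability of the states as functions of the random sources *)

Section StateMeasurability.
Variables (R : realType) (n d : nat) (f : 'I_n -> 'rV[R]_d -> R)
  (fs g : 'rV[R]_d -> R) (q : parameters R) (L : R).
Hypotheses (L0 : 0 <= L) (sf : forall i, smooth L (f i)) (sfs : smooth L fs)
  (sg : smooth L g).

Definition measurable_state dX (X : measurableType dX)
    (s : X -> state R n d) :=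
  [/\ forall i, measurable_vec (fun w => x_cl (s w) i),
      measurable_vec (fun w => x_srv (s w)),
      measurable_vec (fun w => y_aux (s w)) &
    [/\ forall i, measurable_vec (fun w => u_cl (s w) i),
      measurable_vec (fun w => u_srv (s w)) &
      measurable_vec (fun w => u_y (s w))]].

(** The coin and the subset are frozen here. The space [X] is arbitrary because the step is viewed
    as a function on the sample space, on a product of seed spaces, and on the past times the
    seeds. *)
Lemma measurable_step dX (X : measurableType dX) dU (U : measurableType dU)
    dV (V : measurableType dV) t th A
    (C : 'I_n -> {set 'I_d} -> U -> 'rV[R]_d -> 'rV[R]_d)
    (Cs : {set 'I_d} -> V -> 'rV[R]_d -> 'rV[R]_d)
    (xi : X -> U) (zeta : X -> V) (s : X -> state R n d) :
  (forall i A, jointly_measurable (C i A)) ->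
  (forall A, jointly_measurable (Cs A)) ->
  measurable_fun setT xi -> measurable_fun setT zeta ->
  measurable_state s ->
  measurable_state (fun w => bicolor_step f fs g q t th A
    (fun i A => C i A (xi w)) (fun A => Cs A (zeta w)) (s w)).
Proof.
move=> mC mCs mxi mze [mx mxs my [mu mus muy]].
have mxh i : measurable_vec (fun w => x_cl (s w) i
    - gamma q *: gradient (f i) (x_cl (s w) i) + gamma q *: u_cl (s w) i).
  apply: measurable_vecD; last exact: measurable_vecZ.
  apply: measurable_vecB => //; apply: measurable_vecZ.
  exact: measurable_gradient (sf i) _.
have mxsh : measurable_vec (fun w => x_srv (s w)
    - gamma q *: gradient fs (x_srv (s w)) + gamma q *: u_srv (s w)).
  apply: measurable_vecD; last exact: measurable_vecZ.
  apply: measurable_vecB => //; apply: measurable_vecZ.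
  exact: measurable_gradient sfs _.
have myh : measurable_vec (fun w => y_aux (s w)
    - gamma q *: gradient g (y_aux (s w)) + gamma q *: u_y (s w)).
  apply: measurable_vecD; last exact: measurable_vecZ.
  apply: measurable_vecB => //; apply: measurable_vecZ.
  exact: measurable_gradient sg _.
rewrite /bicolor_step; case: th; last by split => //; split.
have mc i : measurable_vec (fun w => C i A (xi w)
    (Defs.restrict A (x_cl (s w) i - gamma q *: gradient (f i) (x_cl (s w) i)
                 + gamma q *: u_cl (s w) i)
     - Defs.restrict A (y_aux (s w) - gamma q *: gradient g (y_aux (s w))
                   + gamma q *: u_y (s w)))).
  apply: measurable_compressor => //.
  by apply: measurable_vecB; exact: measurable_vec_restrict.
have mcs : measurable_vec (fun w => Cs A (zeta w)
    (Defs.restrict A (x_srv (s w) - gamma q *: gradient fs (x_srv (s w))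
                 + gamma q *: u_srv (s w))
     - Defs.restrict A (y_aux (s w) - gamma q *: gradient g (y_aux (s w))
                   + gamma q *: u_y (s w)))).
  apply: measurable_compressor => //.
  by apply: measurable_vecB; exact: measurable_vec_restrict.
have mcb := measurable_vecZ n%:R^-1 (measurable_vec_sum mc).
split=> [i|||/=].
- apply: measurable_vecD; first exact: measurable_vec_restrict.
  apply: measurable_vecD; apply: measurable_vecZ.
    exact: measurable_vec_restrict.
  by apply: measurable_vecD => //; exact: measurable_vec_restrict.
- apply: measurable_vecD; first exact: measurable_vec_restrict.
  apply: measurable_vecD; last exact: measurable_vecZ.
  by apply: measurable_vecD; apply: measurable_vecZ; exact: measurable_vec_restrict.
- by apply: measurable_vecD => //; exact: measurable_vecZ.
- split=> [i||].
  + apply: measurable_vecB => //; apply: measurable_vecZ.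
    exact: measurable_vecB.
  + apply: measurable_vecB; last exact: measurable_vecZ.
    by apply: measurable_vecD => //; exact: measurable_vecZ.
  + by apply: measurable_vecD => //; exact: measurable_vecZ.
Qed.

(** Only sources of times before [t] are constrained, so that the lemma applies both with the full
    sigma-algebra and with the one generated by the past. *)
Lemma measurable_bicolor dX (X : measurableType dX) dU (U : measurableType dU)
    dV (V : measurableType dV) (theta : nat -> X -> bool)
    (S : nat -> X -> {set 'I_d}) (xi : nat -> X -> U) (zeta : nat -> X -> V)
    (C : nat -> 'I_n -> {set 'I_d} -> U -> 'rV[R]_d -> 'rV[R]_d)
    (Cs : nat -> {set 'I_d} -> V -> 'rV[R]_d -> 'rV[R]_d)
    (s0 : state R n d) t :
  (forall t i A, jointly_measurable (C t i A)) ->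
  (forall t A, jointly_measurable (Cs t A)) ->
  (forall r, (r < t)%N -> forall b, measurable (theta r @^-1` [set b])) ->
  (forall r, (r < t)%N -> forall A, measurable (S r @^-1` [set A])) ->
  (forall r, (r < t)%N -> measurable_fun setT (xi r)) ->
  (forall r, (r < t)%N -> measurable_fun setT (zeta r)) ->
  measurable_state (bicolor f fs g q theta S xi zeta C Cs s0 t).
Proof.
move=> mC mCs; elim: t => [|t IH] mth mS mxi mze.
  by split=> [i|||]; [..|split=> [i||]]; exact: measurable_vec_cst.
have {IH} IH := IH (fun r h => mth r (ltnW h)) (fun r h => mS r (ltnW h))
  (fun r h => mxi r (ltnW h)) (fun r h => mze r (ltnW h)).
pose h w := (theta t w, S t w).
pose F (a : bool * {set 'I_d}) w := bicolor_step f fs g q t a.1 a.2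
  (fun i A => C t i A (xi t w)) (fun A => Cs t A (zeta t w))
  (bicolor f fs g q theta S xi zeta C Cs s0 t w).
have mh a : measurable (h @^-1` [set a]).
  have -> : h @^-1` [set a] = theta t @^-1` [set a.1] `&` S t @^-1` [set a.2].
    by case: a => b A; apply/seteqP; split => w /=; [case|move=> [<- <-]].
  by apply: measurableI; [exact: mth|exact: mS].
have mF a : measurable_state (F a).
  by apply: measurable_step => //; [exact: mxi|exact: mze].
rewrite (_ : bicolor _ _ _ _ _ _ _ _ _ _ _ t.+1 = fun w => F (h w) w)//.
split=> [i j|j|j|].
- apply: (measurable_fun_finite (F := fun a w => x_cl (F a w) i 0 j)) => // a.
  by have [+ _ _ _] := mF a; apply.
- apply: (measurable_fun_finite (F := fun a w => x_srv (F a w) 0 j)) => // a.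
  by have [_ + _ _] := mF a; apply.
- apply: (measurable_fun_finite (F := fun a w => y_aux (F a w) 0 j)) => // a.
  by have [_ _ + _] := mF a; apply.
split=> [i j|j|j].
- apply: (measurable_fun_finite (F := fun a w => u_cl (F a w) i 0 j)) => // a.
  by have [_ _ _ [+ _ _]] := mF a; apply.
- apply: (measurable_fun_finite (F := fun a w => u_srv (F a w) 0 j)) => // a.
  by have [_ _ _ [_ + _]] := mF a; apply.
- apply: (measurable_fun_finite (F := fun a w => u_y (F a w) 0 j)) => // a.
  by have [_ _ _ [_ _ +]] := mF a; apply.
Qed.

Lemma measurable_lyapunov dX (X : measurableType dX) (p : R) (x : 'rV[R]_d)
    (s : X -> state R n d) : measurable_state s ->
  measurable_fun setT (fun w => lyapunov f g q p x (s w)).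
Proof.
move=> [mx mxs my [mu mus muy]].
have me v (z : 'rV[R]_d) : measurable_vec v ->
    measurable_fun setT (fun w : X => enorm (v w - z) ^+ 2).
  move=> mv; apply: measurable_enorm2; apply: measurable_vecB => //.
rewrite /lyapunov.
apply: measurable_funD; apply: measurable_funM => //.
  apply: measurable_funD; last by apply: measurable_funM => //; exact: me.
  apply: measurable_funD; last by apply: measurable_funM => //; exact: me.
  by apply: measurable_sum => i; exact: me.
apply: measurable_funD; last by apply: measurable_funM => //; exact: me.
by apply: measurable_sum => i; exact: me.
Qed.

End StateMeasurability.

(** * Product laws *)

Section ProductLaw.
Local Open Scope ereal_scope.

Lemma ge0_integral_mrestr d (T : measurableType d) (R : realType)
    (mu : {measure set T -> \bar R}) (B : set T) (mB : measurable B)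
    (f : T -> \bar R) : measurable_fun setT f -> (forall x, 0 <= f x) ->
  \int[mrestr mu mB]_x f x = \int[mu]_(x in B) f x.
Proof.
move=> mf f0.
rewrite [RHS](@eq_measure_integral _ _ _ B (mrestr mu mB)); last first.
  by move=> A mA AB; rewrite /= /mrestr setIidl.
rewrite -(setvU B) ge0_integral_setU//.
- rewrite [X in X + _](_ : _ = 0) ?add0e//.
  rewrite (@eq_measure_integral _ _ _ (~` B) mzero) ?integral_measure_zero//.
  move=> A mA AB; rewrite /= /mrestr (_ : A `&` B = set0) ?measure0//.
  by apply/seteqP; split => // x [/AB].
- exact: measurableC.
- by rewrite setvU.
- by apply/disj_setPS => x [].
Qed.

(** Both sides are finite measures in [E]; they agree on a generating pi-system that contains the
    whole space, hence everywhere. *)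
Lemma indep_generated d (T : measurableType d) (R : realType)
    (P : probability T R) (G : set (set T)) (H : set T) :
  G `<=` measurable -> setI_closed G -> G setT -> measurable H ->
  (forall E, G E -> P (E `&` H) = P H * P E) ->
  forall E, <<s G >> E -> P (E `&` H) = P H * P E.
Proof.
move=> Gm GI GT mH PG E sE.
have PHf : P H \is a fin_num by exact: fin_num_measure.
have PH0 : (0 <= fine (P H))%R by exact: fine_ge0.
pose m1 : {measure set T -> \bar R} := mrestr P mH.
pose m2 : {measure set T -> \bar R} := mscale (NngNum PH0) P.
have m2E A : m2 A = P H * P A by rewrite /m2 /= /mscale /= fineK.
rewrite -m2E -[LHS]/(m1 E).
apply: (g_sigma_algebra_measure_unique G Gm (fun=> setT)) sE => //.
- by rewrite bigcup_const//; exists 0%N.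
- by move=> A GA; rewrite m2E -PG.
- move=> _; rewrite /m1 /= /mrestr; apply: le_lt_trans (ltry 1%R).
  by apply: probability_le1; apply: measurableI.
Qed.

(** Uniqueness of measures on the pi-system of rectangles, applied to the image of [P] restricted to
    [B]. *)
Lemma joint_law d d1 d2 (T : measurableType d) (T1 : measurableType d1)
    (T2 : measurableType d2) (R : realType) (P : probability T R)
    (X : T -> T1) (Y : T -> T2)
    (m1 : probability T1 R) (m2 : probability T2 R) (B : set T) (c : R) :
  measurable_fun setT X -> measurable_fun setT Y -> measurable B ->
  (0 <= c)%R ->
  (forall E F, measurable E -> measurable F ->
     P (X @^-1` E `&` Y @^-1` F `&` B) = c%:E * (m1 E * m2 F)) ->
  forall Q, measurable Q ->
    P ((fun w => (X w, Y w)) @^-1` Q `&` B) = c%:E * (m1 \x m2) Q.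
Proof.
move=> mX mY mB c0 h Q mQ.
have mXY : measurable_fun setT (fun w => (X w, Y w)).
  exact: measurable_fun_pair.
pose n1 : {measure set (T1 * T2) -> \bar R} :=
  pushforward (mrestr P mB) (fun w => (X w, Y w)).
pose n2 : {measure set (T1 * T2) -> \bar R} := mscale (NngNum c0) (m1 \x m2).
rewrite -[LHS]/(n1 mXY Q) -[RHS]/(n2 Q).
pose C : set (set (T1 * T2)) := [set A `*` B | A in measurable & B in measurable].
apply: (measure_unique C (fun=> setT)) => //.
- by rewrite measurable_prod_measurableType.
- move=> _ _ [A1 mA1 [A2 mA2 <-]] [B1 mB1 [B2 mB2 <-]].
  rewrite -setXI; exists (A1 `&` B1); first exact: measurableI.
  by exists (A2 `&` B2) => //; exact: measurableI.
- by move=> _; exists setT => //; exists setT => //; rewrite setXTT.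
- by rewrite bigcup_const//; exists 0%N.
- move=> _ [E mE [F mF <-]].
  rewrite /n2 /= /mscale /= product_measure1E//.
  by rewrite -h.
- move=> _; rewrite /n1 /= /pushforward /mrestr /=.
  apply: le_lt_trans (ltry 1%R); apply: probability_le1.
  by rewrite preimage_setT; apply: measurableI.
Qed.

(* The event [B] lets the law of the discrete sources be handled separately. *)
Lemma integral_independent3 d d1 d2 d3 (T : measurableType d)
    (T1 : measurableType d1) (T2 : measurableType d2) (T3 : measurableType d3)
    (R : realType) (P : probability T R)
    (X : T -> T1) (Y : T -> T2) (Z : T -> T3)
    (m1 : probability T1 R) (m2 : probability T2 R) (m3 : probability T3 R)
    (B : set T) (c : R) (f : (T1 * T2) * T3 -> \bar R) :
  measurable_fun setT X -> measurable_fun setT Y -> measurable_fun setT Z ->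
  measurable B -> (0 <= c)%R ->
  (forall E F G, measurable E -> measurable F -> measurable G ->
     P (X @^-1` E `&` Y @^-1` F `&` (Z @^-1` G `&` B))
       = c%:E * (m1 E * m2 F * m3 G)) ->
  measurable_fun setT f -> (forall x, 0 <= f x) ->
  \int[P]_(w in B) f (X w, Y w, Z w) =
  c%:E * \int[m1]_x \int[m2]_y \int[m3]_z f (x, y, z).
Proof.
move=> mX mY mZ mB c0 h mf f0.
have mXY : measurable_fun setT (fun w => (X w, Y w)).
  exact: measurable_fun_pair.
have mXYZ : measurable_fun setT (fun w => (X w, Y w, Z w)).
  exact: measurable_fun_pair.
pose m12 : probability (T1 * T2)%type R := m1 \x m2.
have law : forall Q, measurable Q ->
    P ((fun w => (X w, Y w, Z w)) @^-1` Q `&` B) = c%:E * (m12 \x m3) Q.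
  (* The two-variable law is used twice: for the pair against [Z], then for [X] against [Y] with the
     event that [Z] lies in [G] merged into [B] and [m3 G] into the constant. *)
  apply: joint_law => // Q G mQ mG.
  have mZG : measurable (Z @^-1` G) by rewrite -[X in measurable X]setTI; exact: mZ.
  have m3f : m3 G \is a fin_num by exact: fin_num_measure.
  rewrite -setIA.
  have -> : c%:E * (m12 Q * m3 G) = (c * fine (m3 G))%:E * (m1 \x m2) Q.
    by rewrite EFinM fineK// -muleA [m3 G * _]muleC.
  apply: joint_law => //.
  - exact: measurableI.
  - by rewrite mulr_ge0// fine_ge0.
  - move=> E F mE mF; rewrite h// EFinM fineK// -[RHS]muleA.
    by congr (_ * _); rewrite muleC.
rewrite -(ge0_integral_mrestr P mB (f := fun w => f (X w, Y w, Z w)))//; last first.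
  exact: measurableT_comp mf mXYZ.
transitivity (\int[pushforward (mrestr P mB) (fun w => (X w, Y w, Z w))]_y f y).
  by rewrite ge0_integral_pushforward// preimage_setT.
rewrite (@eq_measure_integral _ _ _ setT (mscale (NngNum c0) (m12 \x m3))); last first.
  by move=> Q mQ _; rewrite /= /pushforward /mrestr /mscale /= -law.
rewrite ge0_integral_mscale//; congr (_ * _).
rewrite fubini_tonelli1// /fubini_F.
rewrite fubini_tonelli1//.
  exact: measurable_fun_fubini_tonelli_F.
by move=> x; apply: integral_ge0.
Qed.

End ProductLaw.

(** * One coordinate of the Lyapunov function *)

Section Potential.
Variables (R : realType) (n : nat).
Variables (ga c re rho : R).
Hypotheses (n0 : (0 < n)%N) (ga0 : 0 < ga) (c0 : 0 < c) (rho0 : 0 < rho).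
Implicit Types (X V a e v : 'I_n -> R).

Let N0 : 0 < n%:R :> R. Proof. by rewrite ltr0n. Qed.

(* The contribution of one coordinate to the Lyapunov function. *)
Definition pot X (Xs Y : R) V (Vy : R) : R :=
  ga^-1 * (\sum_i X i ^+ 2 + 2 * n%:R * Xs ^+ 2 + n%:R * Y ^+ 2)
  + c * (\sum_i V i ^+ 2 + n%:R * Vy ^+ 2).

Lemma pot_ge0 X Xs Y V Vy : 0 <= pot X Xs Y V Vy.
Proof.
have S0 (h : 'I_n -> R) : 0 <= \sum_i h i ^+ 2.
  by apply: sumr_ge0 => i _; exact: sqr_ge0.
have N1 (x : R) : 0 <= n%:R * x ^+ 2 by rewrite mulr_ge0 ?sqr_ge0.
have N2 (x : R) : 0 <= 2 * n%:R * x ^+ 2 by rewrite -mulrA mulr_ge0.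
rewrite /pot; apply: addr_ge0; apply: mulr_ge0; rewrite ?invr_ge0 ?(ltW ga0) ?(ltW c0)//.
  by apply: addr_ge0 => //; exact: addr_ge0.
exact: addr_ge0.
Qed.

Definition mean a : R := n%:R^-1 * \sum_i a i.

Lemma mul_mean a : n%:R * mean a = \sum_i a i.
Proof. by rewrite /mean mulrA mulfV ?mul1r// gt_eqF. Qed.

(* The same after a communication round: [a], [as_], [ay] are the errors of
   the local steps, [v], [vy] those of the control variates, and [e], [es] the
   compression errors of the clients and of the server. The constant [re]
   stands for [r * eta]. *)
Definition pot_round a (as_ ay : R) v (vy : R) e (es : R) : R :=
  pot (fun i => a i - rho * (a i - as_) + rho * es)
      (as_ + rho / 2 * (mean a - as_) + rho / 2 * (ay - as_) + rho / 2 * mean e)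
      (ay + rho * (as_ - ay) + rho * es)
      (fun i => v i - re * (a i - as_) - re * (e i - es))
      (vy + re * (as_ - ay) + re * es).

Lemma sum_sqrD a (b : 'I_n -> R) :
  \sum_i (a i + b i) ^+ 2
    = \sum_i a i ^+ 2 + 2 * \sum_i a i * b i + \sum_i b i ^+ 2.
Proof.
rewrite mulr_sumr -!big_split; apply: eq_bigr => i _ /=; ring.
Qed.

Lemma sum_cst (x : R) : \sum_(i < n) x = n%:R * x.
Proof. by rewrite sumr_const card_ord mulr_natl. Qed.

(* If the control variates balance, the local gradient steps [w] absorb the
   cross term by completing the square in [w + ga * v]. *)
Lemma pot_cross_le (w v : 'I_n -> R) (ws vs wy vy : R) :
  \sum_i v i = - (2 * n%:R * vs) - n%:R * vy ->
  pot (fun i => w i + ga * v i) (ws + ga * vs) (wy + ga * vy) v vy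
  - 2 * (\sum_i v i * (w i + ga * v i - (ws + ga * vs))
         + n%:R * (vy * (wy + ga * vy - (ws + ga * vs))))
  <= ga^-1 * (\sum_i w i ^+ 2 + 2 * n%:R * ws ^+ 2 + n%:R * wy ^+ 2)
     + (c - ga) * (\sum_i v i ^+ 2 + n%:R * vy ^+ 2).
Proof.
move=> bal; rewrite /pot.
have -> : \sum_i v i * (w i + ga * v i - (ws + ga * vs)) =
    \sum_i v i * w i + ga * \sum_i v i ^+ 2 - (ws + ga * vs) * \sum_i v i.
  by rewrite !mulr_sumr -sumrN -!big_split; apply: eq_bigr => i _ /=; ring.
have -> : \sum_i (w i + ga * v i) ^+ 2 =
    \sum_i w i ^+ 2 + 2 * ga * \sum_i v i * w i + ga ^+ 2 * \sum_i v i ^+ 2.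
  by rewrite !mulr_sumr -!big_split; apply: eq_bigr => i _ /=; ring.
rewrite bal; have gn : ga != 0 by rewrite gt_eqF.
(* Exactly the gap between the two sides: completing the square at the server leaves
   [- ga * (2 * n%:R * vs ^+ 2)], which is dropped. *)
have h : 0 <= ga * (2 * n%:R * vs ^+ 2).
  by rewrite mulr_ge0 ?(ltW ga0)// -mulrA mulr_ge0// mulr_ge0 ?sqr_ge0.
rewrite -subr_ge0; apply: le_trans h _.
rewrite -subr_ge0 le_eqVlt; apply/orP; left; apply/eqP.
by field.
Qed.

(** Expansion in the server error. The linear coefficient involves the client errors [e], but it is
    constant once these are fixed. *)
Lemma pot_round_server a as_ ay v vy e es :
  pot_round a as_ ay v vy e es =
  pot_round a as_ ay v vy e 0
  + (ga^-1 * (2 * rho * (\sum_i (a i - rho * (a i - as_)))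
              + 2 * n%:R * rho * (ay + rho * (as_ - ay)))
     + c * (2 * re * (\sum_i (v i - re * (a i - as_) - re * e i))
            + 2 * n%:R * re * (vy + re * (as_ - ay)))) * es
  + 2 * n%:R * (rho ^+ 2 / ga + c * re ^+ 2) * es ^+ 2.
Proof.
rewrite /pot_round /pot.
have -> : \sum_i (v i - re * (a i - as_) - re * (e i - es)) ^+ 2 =
   \sum_i (v i - re * (a i - as_) - re * e i + re * es) ^+ 2.
  by apply: eq_bigr => i _; congr (_ ^+ 2); ring.
have -> : \sum_i (v i - re * (a i - as_) - re * (e i - 0)) ^+ 2 =
   \sum_i (v i - re * (a i - as_) - re * e i) ^+ 2.
  by apply: eq_bigr => i _; rewrite subr0.
have -> : \sum_i (a i - rho * (a i - as_) + rho * 0) ^+ 2 =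
   \sum_i (a i - rho * (a i - as_)) ^+ 2.
  by apply: eq_bigr => i _; rewrite mulr0 addr0.
rewrite !(sum_sqrD _ (fun=> _)) !sum_cst -!mulr_suml.
by ring.
Qed.

(** Expansion in the client errors once the server error is gone. The primal part sees only their
    mean, through the server model, hence [omega_av]; the dual part sees each of them, hence
    [omega]. *)
Lemma pot_round_client a as_ ay v vy e :
  pot_round a as_ ay v vy e 0 =
  pot_round a as_ ay v vy (fun=> 0) 0
  + \sum_i (2 * rho / ga * (as_ + rho / 2 * (mean a - as_) + rho / 2 * (ay - as_))
            - 2 * c * re * (v i - re * (a i - as_))) * e i
  + (n%:R * rho ^+ 2 / (2 * ga) * mean e ^+ 2
     + c * re ^+ 2 * \sum_i e i ^+ 2).
Proof.
rewrite /pot_round /pot.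
have -> : \sum_i (v i - re * (a i - as_) - re * (e i - 0)) ^+ 2 =
   \sum_i (v i - re * (a i - as_) + (- re) * e i) ^+ 2.
  by apply: eq_bigr => i _; rewrite subr0 mulNr.
have -> : \sum_i (v i - re * (a i - as_) - re * (0 - 0)) ^+ 2 =
   \sum_i (v i - re * (a i - as_)) ^+ 2.
  by apply: eq_bigr => i _; rewrite subrr mulr0 subr0.
rewrite !(sum_sqrD _ (fun i => - re * e i)).
set A1 := \sum_i (a i - _ + _) ^+ 2; set B1 := \sum_i (v i - _) ^+ 2.
set sg := as_ + _ + _.
have -> : mean (fun=> 0 : R) = 0 by rewrite /mean big1 ?mulr0.
have -> : \sum_i (- re * e i) ^+ 2 = re ^+ 2 * \sum_i e i ^+ 2.
  by rewrite mulr_sumr; apply: eq_bigr => i _; ring.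
have -> : \sum_i (2 * rho / ga * sg - 2 * c * re * (v i - re * (a i - as_))) * e i
  = 2 * rho / ga * sg * (n%:R * mean e)
    + 2 * c * \sum_i (v i - re * (a i - as_)) * (- re * e i).
  rewrite mul_mean !mulr_sumr -big_split.
  by apply: eq_bigr => i _ /=; ring.
by field; rewrite gt_eqF.
Qed.

(** The variance of [a] about its mean is nonnegative. *)
Lemma sum_sqr_le a : (\sum_i a i) ^+ 2 <= n%:R * \sum_i a i ^+ 2.
Proof.
have : 0 <= \sum_i (a i - mean a) ^+ 2 by apply: sumr_ge0 => i _; exact: sqr_ge0.
have -> : \sum_i (a i - mean a) ^+ 2 = \sum_i a i ^+ 2 - (\sum_i a i) ^+ 2 / n%:R.
  rewrite (sum_sqrD a (fun=> - mean a)) sum_cst -mulr_suml /mean.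
  by field; rewrite gt_eqF.
by rewrite subr_ge0 ler_pdivrMr// [_ * n%:R]mulrC.
Qed.

(** The budget that fixes [rho] and [et]. To first order the primal part drops by
    [2 * rho * D / ga]: the weights of [pot] cancel all terms linear in [as_]. The primal squares
    and noise cost at most [rho ^+ 2 * (2 + omav + 2 * oms) * D / ga = rho * D / ga], the dual ones
    at most [et * (1 + 2 * om + 2 * oms) * D / ga = rho * D / ga]. Only the cross term survives. *)
Lemma pot_round_le a as_ ay v vy (om oms omav et : R) :
  0 <= om -> 0 <= oms -> 0 <= omav ->
  rho * (2 + omav + 2 * oms) = 1 -> c * re ^+ 2 = et / ga ->
  et * (1 + 2 * om + 2 * oms) = rho ->
  pot_round a as_ ay v vy (fun=> 0) 0
  + 2 * n%:R * (rho ^+ 2 / ga + c * re ^+ 2) * (oms * (as_ - ay) ^+ 2)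
  + n%:R * rho ^+ 2 / (2 * ga) * (omav / n%:R * \sum_i (a i - ay) ^+ 2)
  + c * re ^+ 2 * (om * \sum_i (a i - ay) ^+ 2)
  <= pot a as_ ay v vy
     - 2 * c * re * (\sum_i v i * (a i - as_) + n%:R * (vy * (ay - as_))).
Proof.
move=> om0 oms0 omav0 hrho hc het.
have et0 : 0 < et.
  by rewrite -(@pmulr_lgt0 _ (1 + 2 * om + 2 * oms)) ?het// ; lra.
pose t i := a i - as_; pose ty := ay - as_.
set S := \sum_i v i * _.
pose Q := \sum_i t i ^+ 2; pose T := \sum_i t i.
have TQ : T ^+ 2 <= n%:R * Q by exact: sum_sqr_le.
have T2 : n%:R * (n%:R^-1 * T) ^+ 2 <= Q.
  have -> : n%:R * (n%:R^-1 * T) ^+ 2 = T ^+ 2 / n%:R by field; rewrite gt_eqF.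
  by rewrite ler_pdivrMr// mulrC.
have Q0 : 0 <= Q by apply: sumr_ge0 => i _; exact: sqr_ge0.
pose D := Q + n%:R * ty ^+ 2.
have meanE : mean a - as_ = n%:R^-1 * T.
  rewrite /T /t big_split /= sum_cst /mean mulrDr mulrA mulVf ?gt_eqF//.
  by rewrite mul1r.
have dE : \sum_i (a i - ay) ^+ 2 = Q - 2 * ty * T + n%:R * ty ^+ 2.
  have -> : \sum_i (a i - ay) ^+ 2 = \sum_i (t i + - ty) ^+ 2.
    by apply: eq_bigr => i _; rewrite /t /ty; congr (_ ^+ 2); ring.
  by rewrite (sum_sqrD t (fun=> - ty)) sum_cst -mulr_suml -/Q -/T; ring.
(* The factor 2 is the price of compressing differences to [ay] while [D] measures differences to
   [as_]. *)
have d2 : \sum_i (a i - ay) ^+ 2 <= 2 * D.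
  rewrite dE /D.
  have : 0 <= n%:R * (n%:R^-1 * T + ty) ^+ 2 by rewrite mulr_ge0 ?sqr_ge0// ltW.
  have -> : n%:R * (n%:R^-1 * T + ty) ^+ 2
      = n%:R * (n%:R^-1 * T) ^+ 2 + 2 * T * ty + n%:R * ty ^+ 2.
    by field; rewrite gt_eqF.
  by lra.
have d0 : 0 <= \sum_i (a i - ay) ^+ 2.
  by apply: sumr_ge0 => i _; exact: sqr_ge0.
set dd := \sum_i (a i - ay) ^+ 2 in d0 d2 *.
have ty2 : n%:R * ty ^+ 2 <= D by rewrite /D lerDr.
have D0 : 0 <= D by rewrite /D addr_ge0// mulr_ge0 ?sqr_ge0// ltW.
rewrite /pot_round /pot.
have -> : \sum_i (v i - re * (a i - as_) - re * (0 - 0)) ^+ 2 =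
   \sum_i v i ^+ 2 - 2 * re * S + re ^+ 2 * Q.
  rewrite /S /Q !mulr_sumr -sumrN -!big_split.
  by apply: eq_bigr => i _ /=; rewrite /t; ring.
have -> : \sum_i (a i - rho * (a i - as_) + rho * 0) ^+ 2 =
   \sum_i a i ^+ 2 - 2 * rho * (Q + as_ * T) + rho ^+ 2 * Q.
  rewrite /Q /T !(mulr_sumr, =^~ big_split) -sumrN -!big_split.
  by apply: eq_bigr => i _ /=; rewrite /t; ring.
have -> : mean (fun=> 0 : R) = 0 by rewrite /mean big1 ?mulr0.
rewrite meanE !mulr0 !addr0.
set tb := n%:R^-1 * T in T2 *.
have TE : T = n%:R * tb by rewrite /tb mulrA mulfV ?mul1r// gt_eqF.
have -> : as_ - ay = - ty by rewrite /ty; ring.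
have -> : ay = as_ + ty by rewrite /ty; ring.
rewrite -/ty sqrrN hc TE.
clearbody S Q tb dd.
set SA := \sum_i a i ^+ 2; set SV := \sum_i v i ^+ 2.
have H1 : 2 * n%:R * (rho ^+ 2 / 4 * (tb + ty) ^+ 2) <= rho ^+ 2 * D.
  have : 0 <= rho ^+ 2 * (n%:R * (tb - ty) ^+ 2).
    by rewrite mulr_ge0 ?sqr_ge0// mulr_ge0 ?sqr_ge0// ltW.
  have : rho ^+ 2 * (n%:R * tb ^+ 2) <= rho ^+ 2 * Q by rewrite ler_wpM2l ?sqr_ge0.
  by rewrite /D; lra.
have H2 : rho ^+ 2 * (oms * (n%:R * ty ^+ 2)) <= rho ^+ 2 * (oms * D).
  by rewrite !ler_wpM2l ?sqr_ge0.
have H3 : rho ^+ 2 * (omav * dd) <= rho ^+ 2 * (omav * (2 * D)).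
  by rewrite !ler_wpM2l ?sqr_ge0.
have H4 : et * (oms * (n%:R * ty ^+ 2)) <= et * (oms * D).
  by rewrite !ler_wpM2l// ltW.
have H5 : et * (om * dd) <= et * (om * (2 * D)).
  by rewrite !ler_wpM2l// ltW.
have E1 : rho ^+ 2 * (2 + omav + 2 * oms) * D = rho * D.
  by rewrite expr2 -[rho * rho * _]mulrA hrho mulr1.
have E2 : et * (1 + 2 * om + 2 * oms) * D = rho * D by rewrite het.
have gai : 0 < ga^-1 by rewrite invr_gt0.
rewrite -subr_ge0.
(* [Z] is [ga] times the right side minus the left side once [c * re ^+ 2] is replaced by [et / ga];
   this replacement is the discrepancy settled by [hc1] at the end. *)
pose Z := rho * D - rho ^+ 2 * Q - rho ^+ 2 * (n%:R * ty ^+ 2)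
  - 2 * n%:R * (rho ^+ 2 / 4 * (tb + ty) ^+ 2) + rho * D
  - 2 * (rho ^+ 2 * (oms * (n%:R * ty ^+ 2)))
  - 2 * (et * (oms * (n%:R * ty ^+ 2)))
  - rho ^+ 2 * (omav * dd) / 2 - et * (om * dd) - et * D.
have Z0 : 0 <= Z.
  rewrite /Z; have : D = Q + n%:R * ty ^+ 2 by [].
  move: H1 H2 H3 H4 H5 E1 E2; clearbody D.
  move=> H1 H2 H3 H4 H5 E1 E2 DE.
  have E3 : rho ^+ 2 * D = rho ^+ 2 * Q + rho ^+ 2 * (n%:R * ty ^+ 2).
    by rewrite DE mulrDr.
  by lra.
have := mulr_ge0 (ltW gai) Z0.
congr (0 <= _).
have hc1 : c * re ^+ 2 * D = et / ga * D by rewrite hc.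
have nn : n%:R != 0 :> R by rewrite gt_eqF.
have gg : ga != 0 by rewrite gt_eqF.
rewrite /Z.
apply/eqP; rewrite -subr_eq0; apply/eqP.
move: hc1; rewrite /D => hc1.
transitivity (c * re ^+ 2 * (Q + n%:R * ty ^+ 2) - et / ga * (Q + n%:R * ty ^+ 2)); last first.
  by rewrite hc1 subrr.
by field; rewrite gg nn.
Qed.

End Potential.

(** * Expectation of affine functions of centred errors *)

Section Expectation.
Context (R : realType) (d : measure_display) (T : measurableType d).
Variable P : probability T R.
Local Open Scope ereal_scope.

Lemma expectationE (X : T -> R) : 'E_P[X] = \int[P]_w (X w)%:E.
Proof. by rewrite unlock. Qed.

(** The integral is a difference of two nonnegative extended reals; such a difference is finite only
    if both terms are. Thus unbiasedness, given as an equality of expectations, already contains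
    integrability. *)
Lemma fin_integral_integrable (h : T -> R) (a : R) :
  measurable_fun setT h -> \int[P]_w (h w)%:E = a%:E ->
  P.-integrable setT (EFin \o h).
Proof.
move=> mh; rewrite integralE => E.
have mE : measurable_fun setT (EFin \o h) by exact/measurable_EFinP.
apply/integrableP; split => //.
rewrite -[fun x => _]/(abse \o (EFin \o h)) fune_abse ge0_integralD//; last 2 first.
- exact: measurable_funepos.
- exact: measurable_funeneg.
move: E.
set p := integral _ _ _; set m := integral _ _ _.
have : 0 <= p by apply: integral_ge0.
have : 0 <= m by apply: integral_ge0.
by case: p => [p||]; case: m => [m||] //= _ _ _; exact: ltry.
Qed.

(** The common form of both averaging stages: a constant, a linear term in centred errors, and a
    nonnegative quadratic term with bounded mean. *)
Lemma integral_affine_le (I : finType) (a : R) (l : I -> R)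
    (e : I -> T -> R) (Q : T -> R) (b : R) :
  (forall i, measurable_fun setT (e i)) ->
  (forall i, \int[P]_w (e i w)%:E = 0) ->
  measurable_fun setT Q -> (forall w, (0 <= Q w)%R) ->
  \int[P]_w (Q w)%:E <= b%:E ->
  \int[P]_w (a + \sum_i l i * e i w + Q w)%:E <= (a + b)%:E.
Proof.
move=> me e0 mQ Q0 Qb.
have ie i : P.-integrable setT (EFin \o e i).
  by apply: (@fin_integral_integrable _ 0%R); [exact: me|exact: e0].
have ile i : P.-integrable setT (fun w => (l i)%:E * (e i w)%:E).
  by apply: integrableZl => //; exact: ie.
have isum : P.-integrable setT (fun w => \sum_i (l i)%:E * (e i w)%:E).
  exact: integrable_sum.
have icst : P.-integrable setT (EFin \o (cst a : T -> R)).
  exact: finite_measure_integrable_cst.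
have iQ : P.-integrable setT (EFin \o Q).
  apply/integrableP; split; first exact/measurable_EFinP.
  under eq_integral do rewrite gee0_abs ?lee_fin//.
  exact: le_lt_trans Qb (ltry _).
have iaff : P.-integrable setT
    (fun w => a%:E + \sum_i (l i)%:E * (e i w)%:E).
  exact: integrableD.
have -> : \int[P]_w (a + \sum_i l i * e i w + Q w)%:E =
    \int[P]_w ((a%:E + \sum_i (l i)%:E * (e i w)%:E) + (Q w)%:E).
  apply: eq_integral => w _; rewrite !EFinD sumEFin.
  by congr (_ + _ + _)%E; rewrite -sumEFin; apply: eq_bigr => i _; rewrite EFinM.
rewrite integralD//.
rewrite integralD// integral_cst//= probability_setT mule1.
rewrite integral_sum//.
rewrite big1 ?adde0; last first.
  move=> i _; rewrite integralZl//; last exact: ie.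
  by rewrite -[X in _ * X]/(integral P setT (fun w => (e i w)%:E)) e0// mule0.
by rewrite EFinD leeD2l.
Qed.

End Expectation.

(** * A communication round, coordinatewise *)

Lemma sum_pot (R : realType) n d (ga c : R) (X : 'I_n -> 'rV[R]_d)
    (Xs Y : 'rV[R]_d) (V : 'I_n -> 'rV[R]_d) (Vy : 'rV[R]_d) :
  \sum_j pot ga c (fun i => X i 0 j) (Xs 0 j) (Y 0 j) (fun i => V i 0 j) (Vy 0 j)
  = ga^-1 * (\sum_i enorm (X i) ^+ 2 + 2 * n%:R * enorm Xs ^+ 2
             + n%:R * enorm Y ^+ 2)
    + c * (\sum_i enorm (V i) ^+ 2 + n%:R * enorm Vy ^+ 2).
Proof.
rewrite /pot big_split -!mulr_sumr !big_split /= -!mulr_sumr.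
rewrite exchange_big [X in _ + _ * (X + _)]exchange_big /=.
have E (x : 'rV[R]_d) : \sum_j x 0 j ^+ 2 = enorm x ^+ 2.
  by rewrite enorm_sqr; apply: eq_bigr => j _; rewrite expr2.
by rewrite !E; congr (_ * (_ + _ + _) + _ * (_ + _)); apply: eq_bigr => i _; rewrite E.
Qed.

Section RoundAlgebra.
Variables (R : realType) (n d : nat).
Variables (f : 'I_n -> 'rV[R]_d -> R) (fs g : 'rV[R]_d -> R).
Variables (q : parameters R) (p : R) (xstar : 'rV[R]_d) (t : nat).
Implicit Types (s : state R n d) (A : {set 'I_d}).

Definition cl_hat s i : 'rV[R]_d :=
  x_cl s i - gamma q *: gradient (f i) (x_cl s i) + gamma q *: u_cl s i.
Definition srv_hat s : 'rV[R]_d :=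
  x_srv s - gamma q *: gradient fs (x_srv s) + gamma q *: u_srv s.
Definition y_hat s : 'rV[R]_d :=
  y_aux s - gamma q *: gradient g (y_aux s) + gamma q *: u_y s.

Definition dual_weight : R :=
  d%:R ^+ 2 * gamma q / (p ^+ 2 * (ksize q)%:R ^+ 2 * Defs.eta q).
Definition dual_step : R :=
  prob q t.+1 * (ksize q)%:R / (d%:R * gamma q) * Defs.eta q.

Definition cl_diff A s i : 'rV[R]_d :=
  Defs.restrict A (cl_hat s i) - Defs.restrict A (y_hat s).
Definition srv_diff A s : 'rV[R]_d :=
  Defs.restrict A (srv_hat s) - Defs.restrict A (y_hat s).

Definition pot_at s j : R :=
  pot (gamma q) dual_weight
    (fun i => (x_cl s i - xstar) 0 j) ((x_srv s - xstar) 0 j)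
    ((y_aux s - xstar) 0 j) (fun i => (u_cl s i - gradient (f i) xstar) 0 j)
    ((u_y s - gradient g xstar) 0 j).

Definition pot_hat s j : R :=
  pot (gamma q) dual_weight
    (fun i => (cl_hat s i - xstar) 0 j) ((srv_hat s - xstar) 0 j)
    ((y_hat s - xstar) 0 j) (fun i => (u_cl s i - gradient (f i) xstar) 0 j)
    ((u_y s - gradient g xstar) 0 j).

Definition pot_hat_round s j : ('I_n -> R) -> R -> R :=
  pot_round (gamma q) dual_weight dual_step (rho q)
    (fun i => (cl_hat s i - xstar) 0 j) ((srv_hat s - xstar) 0 j)
    ((y_hat s - xstar) 0 j) (fun i => (u_cl s i - gradient (f i) xstar) 0 j)
    ((u_y s - gradient g xstar) 0 j).

Lemma lyapunov_pot s : lyapunov f g q p xstar s = \sum_j pot_at s j.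
Proof. by rewrite sum_pot. Qed.

Lemma lyapunov_local A C Cs s :
  lyapunov f g q p xstar (bicolor_step f fs g q t false A C Cs s)
    = \sum_j pot_hat s j.
Proof. by rewrite lyapunov_pot; apply: eq_bigr => j _; rewrite /pot_at. Qed.

(* The state after a communication round, with the local steps and the
   compressed vectors as free variables. *)
Definition round_state A (a : 'I_n -> 'rV[R]_d) (as_ ay : 'rV[R]_d)
    (c : 'I_n -> 'rV[R]_d) (cs : 'rV[R]_d) s : state R n d :=
  let cbar := n%:R^-1 *: \sum_(i < n) c i in
  let r := prob q t.+1 * (ksize q)%:R / (d%:R * gamma q) in
  State
    (fun i => Defs.restrict (~: A) (a i)
       + ((1 - rho q) *: Defs.restrict A (a i)
          + rho q *: (cs + Defs.restrict A ay)))
    (Defs.restrict (~: A) as_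
       + ((1 - (rho q + rho_y q) / 2) *: Defs.restrict A as_
          + ((rho q + rho_y q) / 2) *: Defs.restrict A ay
          + (rho q / 2) *: cbar))
    (ay + rho_y q *: cs)
    (fun i => u_cl s i - (r * Defs.eta q) *: (c i - cs))
    (u_srv s + (r * Defs.eta q / 2) *: cbar
       - (r * (eta_y q + Defs.eta q) / 2) *: cs)
    (u_y s + (r * eta_y q) *: cs).

Lemma bicolor_step_round A C Cs s :
  bicolor_step f fs g q t true A C Cs s =
  round_state A (cl_hat s) (srv_hat s) (y_hat s)
    (fun i => C i A (cl_diff A s i)) (Cs A (srv_diff A s)) s.
Proof. by []. Qed.

Lemma pot_at_round_in A (a : 'I_n -> 'rV[R]_d) (as_ ay : 'rV[R]_d)
    (c : 'I_n -> 'rV[R]_d) (cs : 'rV[R]_d) s j : (0 < n)%N ->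
  rho_y q = rho q -> eta_y q = Defs.eta q -> j \in A ->
  pot_at (round_state A a as_ ay c cs s) j =
  pot_round (gamma q) dual_weight dual_step (rho q)
    (fun i => (a i - xstar) 0 j) ((as_ - xstar) 0 j) ((ay - xstar) 0 j)
    (fun i => (u_cl s i - gradient (f i) xstar) 0 j)
    ((u_y s - gradient g xstar) 0 j)
    (fun i => c i 0 j - (a i 0 j - ay 0 j))
    (cs 0 j - (as_ 0 j - ay 0 j)).
Proof.
move=> n0 ry ey jA.
have nn : n%:R != 0 :> R by rewrite pnatr_eq0 -lt0n.
have E1 : mean (fun i => (a i - xstar) 0 j)
    = n%:R^-1 * (\sum_i a i 0 j) - xstar 0 j.
  rewrite /mean (eq_bigr (fun i => a i 0 j - xstar 0 j)).
    by rewrite big_split /= sum_cst; field.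
  by move=> i _; rewrite !mxE.
have E2 : mean (fun i => c i 0 j - (a i 0 j - ay 0 j))
    = n%:R^-1 * (\sum_i c i 0 j) - n%:R^-1 * (\sum_i a i 0 j) + ay 0 j.
  rewrite /mean (eq_bigr (fun i => c i 0 j + - a i 0 j + ay 0 j)).
    by rewrite !big_split /= sum_cst sumrN; field.
  by move=> i _; ring.
rewrite /pot_round E1 E2 /pot_at /round_state /dual_step /=; congr pot.
- by apply/funext => i; rewrite !mxE inE jA /=; ring.
- by rewrite !mxE inE jA /= ry summxE; field.
- by rewrite !mxE ry; ring.
- by apply/funext => i; rewrite !mxE; ring.
- by rewrite !mxE ey; ring.
Qed.

Lemma pot_at_round_out A (a : 'I_n -> 'rV[R]_d) (as_ ay : 'rV[R]_d)
    (c : 'I_n -> 'rV[R]_d) (cs : 'rV[R]_d) s j : j \notin A ->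
  (forall i, c i 0 j = 0) -> cs 0 j = 0 ->
  pot_at (round_state A a as_ ay c cs s) j =
  pot (gamma q) dual_weight
    (fun i => (a i - xstar) 0 j) ((as_ - xstar) 0 j) ((ay - xstar) 0 j)
    (fun i => (u_cl s i - gradient (f i) xstar) 0 j)
    ((u_y s - gradient g xstar) 0 j).
Proof.
move=> jA c0 cs0; rewrite /pot_at /round_state /=; congr pot.
- by apply/funext => i; rewrite !mxE inE jA (negbTE jA) cs0; ring.
- by rewrite !mxE inE jA (negbTE jA) summxE big1//; ring.
- by rewrite !mxE cs0; ring.
- by apply/funext => i; rewrite !mxE c0 cs0; ring.
- by rewrite !mxE cs0; ring.
Qed.

(** The steps of [y_aux] and of the control variates are not restricted to [A] explicitly; it is the
    support of the compressed vectors that leaves the coordinates outside [A] with a mere local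
    step. *)
Lemma lyapunov_round A C Cs s :
  (0 < n)%N ->
  rho_y q = rho q -> eta_y q = Defs.eta q ->
  (forall i, supported A (C i A (cl_diff A s i))) ->
  supported A (Cs A (srv_diff A s)) ->
  lyapunov f g q p xstar (bicolor_step f fs g q t true A C Cs s)
  = \sum_(j in ~: A) pot_hat s j
    + \sum_(j in A) pot_hat_round s j
        (fun i => (C i A (cl_diff A s i) - cl_diff A s i) 0 j)
        ((Cs A (srv_diff A s) - srv_diff A s) 0 j).
Proof.
move=> n0 ry ey sC sCs.
rewrite lyapunov_pot bicolor_step_round (bigID (mem (~: A))) /=.
congr (_ + _).
  apply: eq_bigr => j; rewrite inE => jA.
  by rewrite pot_at_round_out// => [i|]; [exact: sC|exact: sCs].
apply: eq_big => [j|j]; first by rewrite inE negbK.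
rewrite inE negbK => jA; rewrite pot_at_round_in// /pot_hat_round.
congr pot_round.
  by apply/funext => i; rewrite [in RHS]mxE; congr (_ + _); rewrite !mxE jA.
by rewrite [in RHS]mxE; congr (_ + _); rewrite !mxE jA.
Qed.

End RoundAlgebra.

(** * Expectation of a communication round *)

Section Round.
Variables (R : realType) (n d : nat).
Variables (f : 'I_n -> 'rV[R]_d -> R) (fs g : 'rV[R]_d -> R).
Variables (q : parameters R) (p : R) (xstar : 'rV[R]_d) (t : nat).
Variables (L om oms omav : R).
Context (dU dV : measure_display) (U : measurableType dU)
  (V : measurableType dV) (m2 : probability U R) (m3 : probability V R).
Variables (C : 'I_n -> {set 'I_d} -> U -> 'rV[R]_d -> 'rV[R]_d)
  (Cs : {set 'I_d} -> V -> 'rV[R]_d -> 'rV[R]_d).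
Hypotheses (n0 : (0 < n)%N) (L0 : 0 <= L).
Hypotheses (sf : forall i, smooth L (f i)) (sfs : smooth L fs)
  (sg : smooth L g).
Hypotheses (om0 : 0 <= om) (oms0 : 0 <= oms) (omav0 : 0 <= omav).
Hypotheses (ga0 : 0 < gamma q) (c0 : 0 < dual_weight d q p)
  (rho0 : 0 < rho q).
Hypotheses (ry : rho_y q = rho q) (ey : eta_y q = Defs.eta q).
Hypothesis hrho : rho q * (2 + omav + 2 * oms) = 1.
Hypothesis heta : Defs.eta q * (1 + 2 * om + 2 * oms) = rho q.
Hypothesis hc :
  dual_weight d q p * dual_step d q t ^+ 2 = Defs.eta q / gamma q.
Hypothesis hC : forall i A, unbiased_compressor m2 om A idfun (C i A).
Hypothesis hCs : forall A, unbiased_compressor m3 oms A idfun (Cs A).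
Hypothesis hav : forall (A : {set 'I_d}) (x : 'I_n -> 'rV[R]_d),
  (forall i, supported A (x i)) ->
  ('E_m2[fun u => (enorm (n%:R^-1 *:
       \sum_(i < n) (C i A u (x i) - x i)) ^+ 2)%R]
    <= (omav / n%:R * \sum_(i < n) enorm (x i) ^+ 2)%:E)%E.

Local Notation c := (dual_weight d q p).
Local Notation re := (dual_step d q t).

Lemma unbiased_error dW (W : measurableType dW) (m : probability W R) (w : R)
    (A : {set 'I_d}) (K : W -> 'rV[R]_d -> 'rV[R]_d) x :
  unbiased_compressor m w A idfun K -> supported A x ->
  [/\ measurable_vec (fun z => K z x - x),
      forall j, (\int[m]_z ((K z x - x) 0%R j)%:E = 0)%E &
      (\int[m]_z (enorm (K z x - x) ^+ 2)%:E <= (w * enorm x ^+ 2)%:E)%E].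
Proof.
move=> [mK hK] sx; have [_ EK VK] := hK x sx.
have mKx : measurable_vec (fun z => K z x).
  apply: (measurable_compressor (xi := idfun)) => //. exact: measurable_id.
split=> [|j|].
- exact: measurable_vecB.
- have := EK j; rewrite expectationE => E.
  have iK := fin_integral_integrable (mKx j) E.
  under eq_integral do rewrite !mxE EFinD.
  rewrite integralD//; last exact: finite_measure_integrable_cst.
  by rewrite E integral_cst//= probability_setT mule1 -EFinD subrr.
- by move: VK; rewrite expectationE.
Qed.

Definition cross s j : R :=
  \sum_i (u_cl s i - gradient (f i) xstar) 0 j
         * ((cl_hat f q s i - xstar) 0 j - (srv_hat fs q s - xstar) 0 j)
  + n%:R * ((u_y s - gradient g xstar) 0 j
            * ((y_hat g q s - xstar) 0 j - (srv_hat fs q s - xstar) 0 j)).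

Variables (s : state R n d) (A : {set 'I_d}).

Local Notation ci := (cl_diff f g q A s).
Local Notation cs := (srv_diff fs g q A s).

Lemma supported_diff (x y : 'rV[R]_d) :
  supported A (Defs.restrict A x - Defs.restrict A y).
Proof. by move=> j jA; rewrite !mxE (negbTE jA) subrr. Qed.

Lemma enorm2_supported (x : 'rV[R]_d) : supported A x ->
  enorm x ^+ 2 = \sum_(j in A) x 0 j ^+ 2.
Proof.
move=> sx; rewrite enorm_sqr /dot [RHS]big_mkcond; apply: eq_bigr => j _ /=.
by rewrite -expr2; case: ifPn => // jA; rewrite sx// expr0n.
Qed.

Lemma sum_supported (x : 'rV[R]_d) (l : 'I_d -> R) : supported A x ->
  \sum_(j in A) l j * x 0 j = \sum_j l j * x 0 j.
Proof.
move=> sx; rewrite [LHS]big_mkcond; apply: eq_bigr => j _ /=.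
by case: ifPn => // jA; rewrite sx// mulr0.
Qed.

(** Psi after a round with client errors [e] and an exact server compressor: what the linear part of
    the average over the server seed leaves. *)
Definition round_base (e : 'I_n -> 'rV[R]_d) : R :=
  \sum_(j in ~: A) pot_hat f fs g q p xstar s j
  + \sum_(j in A) pot_hat_round f fs g q p xstar t s j (fun i => e i 0 j) 0.

(** Coefficients of the squared errors: of the server, of the client average, and of the individual
    clients. *)
Let Ks := 2 * n%:R * (rho q ^+ 2 / gamma q + c * re ^+ 2).
Let Km := n%:R * rho q ^+ 2 / (2 * gamma q).
Let Kc := c * re ^+ 2.

Let step u v := bicolor_step f fs g q t true A (fun i A => C i A u)
  (fun A => Cs A v) s.

Lemma server_expectation u :
  (\int[m3]_v (lyapunov f g q p xstar (step u v))%:E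
   <= (round_base (fun i => C i A u (ci i) - ci i)
       + Ks * (oms * enorm cs ^+ 2))%:E)%E.
Proof.
have [mes es0 Ves] := unbiased_error (hCs A) (@supported_diff (srv_hat fs q s) (y_hat g q s)).
have ses v : supported A (Cs A v cs - cs).
  move=> j jA; rewrite !mxE (negbTE jA).
  have [_ h] := hCs A; have [h1 _ _] := h cs (@supported_diff _ _).
  by rewrite h1// !subrr.
pose e u' i := C i A u' (ci i) - ci i.
(* Only the linearity matters, so the coefficient is read off from the expansion by unification; its
   term averages to zero whatever it is. *)
have /choice[l hl] : forall j, exists l, forall es,
    pot_hat_round f fs g q p xstar t s j (fun i => e u i 0 j) es
    = pot_hat_round f fs g q p xstar t s j (fun i => e u i 0 j) 0 + l * es
      + Ks * es ^+ 2.
  by move=> j; eexists => es; rewrite /pot_hat_round [LHS]pot_round_server.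
have E v : lyapunov f g q p xstar (step u v) =
    round_base (e u) + \sum_j l j * (Cs A v cs - cs) 0 j
    + Ks * enorm (Cs A v cs - cs) ^+ 2.
  rewrite /step lyapunov_round//; last 2 first.
  - by move=> i; have [_ h] := hC i A; have [h1 _ _] := h (ci i) (@supported_diff _ _).
  - by have [_ h] := hCs A; have [h1 _ _] := h cs (@supported_diff _ _).
  rewrite /round_base -!addrA; congr (_ + _).
  rewrite -(sum_supported _ (ses v)) (enorm2_supported (ses v)) mulr_sumr.
  by rewrite -!big_split /=; apply: eq_bigr => j _; rewrite hl addrA.
under eq_integral do rewrite E.
have Ks0 : 0 <= Ks.
  rewrite /Ks mulr_ge0// addr_ge0//; last by rewrite mulr_ge0 ?sqr_ge0 ?ltW.
  by rewrite divr_ge0 ?sqr_ge0// ltW.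
apply: integral_affine_le => //.
- by apply: measurable_funM => //; exact: measurable_enorm2.
- by move=> v; rewrite mulr_ge0 ?sqr_ge0.
- under eq_integral do rewrite EFinM.
  rewrite ge0_integralZl_EFin//; last 2 first.
  + by move=> v _; rewrite lee_fin sqr_ge0.
  + by apply/measurable_EFinP; exact: measurable_enorm2.
  by rewrite [X in (_ <= X)%E](EFinM Ks) lee_wpmul2l// lee_fin.
Qed.

Let e u i := C i A u (ci i) - ci i.
Let em u := n%:R^-1 *: \sum_i e u i.

Let sci i : supported A (ci i).
Proof. exact: supported_diff. Qed.

Let me i : measurable_vec (fun u => e u i).
Proof. by have [] := unbiased_error (hC i A) (@sci i). Qed.

Let m_em : measurable_vec em.
Proof. by apply: measurable_vecZ; exact: measurable_vec_sum. Qed.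

Lemma round_base_affine : exists l : 'I_n * 'I_d -> R, forall u,
  round_base (e u) = round_base (fun=> 0) + \sum_ij l ij * e u ij.1 0 ij.2
    + (Km * enorm (em u) ^+ 2 + Kc * \sum_i enorm (e u i) ^+ 2).
Proof.
have se u i : supported A (e u i).
  move=> j jA; have [_ h] := hC i A; have [h1 _ _] := h _ (@sci i).
  by rewrite /e !mxE h1// (negbTE jA) !subrr.
have sem u : supported A (em u).
  by move=> j jA; rewrite !mxE summxE big1 ?mulr0// => i _; exact: se.
have /choice[l hl] : forall j, exists l : 'I_n -> R, forall e,
    pot_hat_round f fs g q p xstar t s j e 0
    = pot_hat_round f fs g q p xstar t s j (fun=> 0) 0 + \sum_i l i * e i
      + (Km * mean e ^+ 2 + Kc * \sum_i e i ^+ 2).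
  by move=> j; eexists => e'; rewrite /pot_hat_round [LHS]pot_round_client.
exists (fun ij => l ij.2 ij.1) => u.
have -> : \sum_(ij : 'I_n * 'I_d) l ij.2 ij.1 * e u ij.1 0 ij.2 =
    \sum_(j in A) \sum_i l j i * e u i 0 j.
  rewrite exchange_big /= -(pair_bigA _ (fun i j => l j i * e u i 0 j)) /=.
  by apply: eq_bigr => i _; rewrite -(sum_supported (l^~ i) (se u i)).
have -> : \sum_i enorm (e u i) ^+ 2 = \sum_(j in A) \sum_i e u i 0 j ^+ 2.
  rewrite exchange_big /=; apply: eq_bigr => i _.
  by rewrite (enorm2_supported (se u i)).
rewrite (enorm2_supported (sem u)).
rewrite /round_base -!addrA; congr (_ + _).
rewrite !mulr_sumr -!big_split /=; apply: eq_bigr => j _.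
rewrite hl !addrA; congr (_ + _ + _ * _ ^+ 2 + _).
  by congr pot_hat_round; apply/funext => i; rewrite mxE.
by rewrite /mean /em mxE summxE.
Qed.

Lemma measurable_round_base : measurable_fun setT (fun u => round_base (e u)).
Proof.
have [l lE] := round_base_affine; under eq_fun do rewrite lE.
apply: measurable_funD.
  apply: measurable_funD => //; apply: measurable_sum => ij.
  by apply: measurable_funM => //; exact: me.
apply: measurable_funD; apply: measurable_funM => //.
  exact: measurable_enorm2.
by apply: measurable_sum => i; exact: measurable_enorm2.
Qed.

(** Second stage of the average: the server variance has become a constant, because the vector [cs]
    it compresses does not depend on the client seed. *)
Lemma client_expectation :
  (\int[m2]_u (round_base (e u) + Ks * (oms * enorm cs ^+ 2))%:E
   <= (round_base (fun=> 0) + Ks * (oms * enorm cs ^+ 2)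
       + (Km * (omav / n%:R * \sum_i enorm (ci i) ^+ 2)
          + Kc * (om * \sum_i enorm (ci i) ^+ 2)))%:E)%E.
Proof.
have e0 i j : (\int[m2]_u (e u i 0%R j)%:E = 0)%E.
  by have [] := unbiased_error (hC i A) (@sci i).
have Ve i : (\int[m2]_u (enorm (e u i) ^+ 2)%:E <= (om * enorm (ci i) ^+ 2)%:E)%E.
  by have [] := unbiased_error (hC i A) (@sci i).
have [l lE] := round_base_affine.
have E u : round_base (e u) + Ks * (oms * enorm cs ^+ 2) =
    round_base (fun=> 0) + Ks * (oms * enorm cs ^+ 2)
    + \sum_ij l ij * e u ij.1 0 ij.2
    + (Km * enorm (em u) ^+ 2 + Kc * \sum_i enorm (e u i) ^+ 2).
  by rewrite lE; ring.
under eq_integral do rewrite E.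
have Kc0 : 0 <= Kc by rewrite /Kc mulr_ge0 ?sqr_ge0 ?ltW.
have Km0 : 0 <= Km.
  by rewrite /Km mulr_ge0 ?invr_ge0 ?mulr_ge0 ?sqr_ge0// ltW.
have mee i : measurable_fun setT (fun u => enorm (e u i) ^+ 2).
  by apply: measurable_enorm2; exact: me.
have msum : measurable_fun setT (fun u => \sum_i enorm (e u i) ^+ 2).
  by apply: measurable_sum.
have mm : measurable_fun setT (fun u => enorm (em u) ^+ 2).
  exact: measurable_enorm2.
have S0 u : 0 <= \sum_i enorm (e u i) ^+ 2.
  by apply: sumr_ge0 => i _; exact: sqr_ge0.
apply: integral_affine_le => //.
- by move=> [i j]; exact: me.
- by apply: measurable_funD; apply: measurable_funM.
- by move=> u; rewrite addr_ge0// mulr_ge0// sqr_ge0.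
under eq_integral do rewrite EFinD (EFinM Km) (EFinM Kc).
rewrite ge0_integralD//; last 4 first.
- by move=> u _; rewrite mule_ge0 ?lee_fin// sqr_ge0.
- by apply: measurable_funeM; apply/measurable_EFinP.
- by move=> u _; rewrite mule_ge0 ?lee_fin.
- by apply: measurable_funeM; apply/measurable_EFinP.
rewrite !ge0_integralZl_EFin//; last 4 first.
- by move=> u _; rewrite lee_fin.
- by apply/measurable_EFinP.
- by move=> u _; rewrite lee_fin sqr_ge0.
- by apply/measurable_EFinP.
rewrite [X in (_ <= X)%E]EFinD (EFinM Km) (EFinM Kc) leeD// lee_wpmul2l ?lee_fin//.
  by have := hav (fun i => @sci i); rewrite expectationE.
under eq_integral do rewrite -sumEFin.
rewrite ge0_integral_sum//; last 2 first.
- by move=> i; apply/measurable_EFinP.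
- by move=> i u _; rewrite lee_fin sqr_ge0.
rewrite mulr_sumr -sumEFin; apply: lee_sum => i _; exact: Ve.
Qed.

Lemma round_base_le :
  round_base (fun=> 0) + Ks * (oms * enorm cs ^+ 2)
  + (Km * (omav / n%:R * \sum_i enorm (ci i) ^+ 2)
     + Kc * (om * \sum_i enorm (ci i) ^+ 2))
  <= \sum_j pot_hat f fs g q p xstar s j
     - 2 * c * re * \sum_(j in A) cross s j.
Proof.
have -> : enorm cs ^+ 2 = \sum_(j in A)
    ((srv_hat fs q s - xstar) 0 j - (y_hat g q s - xstar) 0 j) ^+ 2.
  rewrite enorm2_supported; last exact: supported_diff.
  by apply: eq_bigr => j jA; rewrite !mxE jA; congr (_ ^+ 2); ring.
have -> : \sum_i enorm (ci i) ^+ 2 = \sum_(j in A) \sum_i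
    ((cl_hat f q s i - xstar) 0 j - (y_hat g q s - xstar) 0 j) ^+ 2.
  rewrite exchange_big /=; apply: eq_bigr => i _.
  rewrite enorm2_supported; last exact: supported_diff.
  by apply: eq_bigr => j jA; rewrite !mxE jA; congr (_ ^+ 2); ring.
rewrite [X in _ <= X - _](bigID (mem (~: A))) /= /round_base -!addrA lerD2l.
have -> : \sum_(j | j \notin ~: A) pot_hat f fs g q p xstar s j
    = \sum_(j in A) pot_hat f fs g q p xstar s j.
  by apply: eq_bigl => j; rewrite inE negbK.
rewrite !mulr_sumr -sumrN -!big_split /=; apply: ler_sum => j jA.
have := @pot_round_le R n (gamma q) c re (rho q) n0 ga0 rho0
  (fun i => (cl_hat f q s i - xstar) 0 j) ((srv_hat fs q s - xstar) 0 j)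
  ((y_hat g q s - xstar) 0 j) (fun i => (u_cl s i - gradient (f i) xstar) 0 j)
  ((u_y s - gradient g xstar) 0 j) om oms omav (Defs.eta q) om0 oms0 omav0
  hrho hc heta.
rewrite /pot_hat_round /pot_hat /cross -/Ks -/Km -/Kc !addrA.
congr (_ <= _); congr (pot_round _ _ _ _ _ _ _ _ _ _ _ + _ + _ + _).
by apply/funext => i; rewrite mxE.
Qed.

Lemma round_expectation :
  (\int[m2]_u \int[m3]_v (lyapunov f g q p xstar (step u v))%:E
   <= (\sum_j pot_hat f fs g q p xstar s j
       - 2 * c * re * \sum_(j in A) cross s j)%:E)%E.
Proof.
have lyap0 (s' : state R n d) : 0 <= lyapunov f g q p xstar s'.
  by rewrite lyapunov_pot; apply: sumr_ge0 => j _; exact: pot_ge0.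
have mst : measurable_state (fun z : U * V => step z.1 z.2).
  apply: (measurable_step _ L0 sf sfs sg) => //.
  - by move=> i B; have [] := hC i B.
  - by move=> B; have [] := hCs B.
  - by split=> [i|||]; [..|split=> [i||]]; exact: measurable_vec_cst.
have mly := measurable_lyapunov f g q p xstar mst.
have mfub : measurable_fun setT (fun u => (\int[m3]_v (lyapunov f g q p xstar (step u v))%:E)%E).
  apply: (@measurable_fun_fubini_tonelli_F _ _ _ _ _ m3
    (fun z => (lyapunov f g q p xstar (step z.1 z.2))%:E)).
    exact/measurable_EFinP.
  by move=> z; rewrite lee_fin.
have mbase : measurable_fun setT (fun u => (round_base (fun i => C i A u (ci i) - ci i)
       + Ks * (oms * enorm cs ^+ 2))%:E).
  by apply/measurable_EFinP; apply: measurable_funD => //; exact: measurable_round_base.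
apply: (@le_trans _ _ (\int[m2]_u (round_base (fun i => C i A u (ci i) - ci i)
       + Ks * (oms * enorm cs ^+ 2))%:E)%E).
  apply: ge0_le_integral => //.
  - by move=> u _; apply: integral_ge0 => v _; rewrite lee_fin.
  - by move=> u _; exact: server_expectation.
apply: le_trans client_expectation _.
by rewrite lee_fin; exact: round_base_le.
Qed.

End Round.

(** * Contraction of the local steps *)

Section Contraction.
Variables (R : realType) (n d : nat).
Variables (f : 'I_n -> 'rV[R]_d -> R) (fs g : 'rV[R]_d -> R).
Variables (q : parameters R) (p : R) (xstar : 'rV[R]_d) (mu L : R).
Hypotheses (n0 : (0 < n)%N) (mu0 : 0 < mu) (L0 : 0 < L).
Hypotheses (sf : forall i, smooth L (f i)) (sfs : smooth L fs)
  (sg : smooth L g).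
Hypotheses (cf : forall i, strongly_convex mu (f i))
  (cfs : strongly_convex mu fs) (cg : strongly_convex mu g).
Hypothesis xmin : forall x, objective f fs g xstar <= objective f fs g x.
Hypothesis gaE : gamma q = L^-1.

Definition dual_balanced (s : state R n d) :=
  n%:R^-1 *: (\sum_(i < n) u_cl s i) + 2 *: u_srv s + u_y s = 0.

(** Up to the common step, the three weighted increments are [cs - cbar], [cbar - 2 cs] and [cs],
    whose sum vanishes. *)
Lemma dual_balanced_step t th A C Cs s : eta_y q = Defs.eta q ->
  dual_balanced s -> dual_balanced (bicolor_step f fs g q t th A C Cs s).
Proof.
move=> ey bs; rewrite /dual_balanced; case: th => //.
rewrite bicolor_step_round.
move: (fun i => _) (Cs A _) => ci cs; rewrite /round_state /= ey.
set r := _ / _.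
rewrite -[RHS]bs; apply/rowP => j; rewrite !mxE !summxE.
have -> : \sum_i (u_cl s i - (r * Defs.eta q) *: (ci i - cs)) 0 j =
    \sum_i u_cl s i 0 j - r * Defs.eta q * (\sum_i ci i 0 j - n%:R * cs 0 j).
  rewrite -sum_cst -sumrB mulr_sumr -sumrB.
  by apply: eq_bigr => i _; rewrite !mxE.
by field; rewrite pnatr_eq0 -lt0n.
Qed.

Lemma cross_pot_hat s j : dual_balanced s ->
  pot_hat f fs g q p xstar s j - 2 * cross f fs g q xstar s j <=
  pot (gamma q) (dual_weight d q p - gamma q)
    (fun i => ((x_cl s i - gamma q *: gradient (f i) (x_cl s i))
               - (xstar - gamma q *: gradient (f i) xstar)) 0 j)
    (((x_srv s - gamma q *: gradient fs (x_srv s))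
      - (xstar - gamma q *: gradient fs xstar)) 0 j)
    (((y_aux s - gamma q *: gradient g (y_aux s))
      - (xstar - gamma q *: gradient g xstar)) 0 j)
    (fun i => (u_cl s i - gradient (f i) xstar) 0 j)
    ((u_y s - gradient g xstar) 0 j).
Proof.
move=> bs.
have gs := minimizer_gradient L0 sf sfs sg xmin.
have nn : n%:R != 0 :> R by rewrite pnatr_eq0 -lt0n.
pose v i := (u_cl s i - gradient (f i) xstar) 0 j.
pose vs := (u_srv s - gradient fs xstar) 0 j.
pose vy := (u_y s - gradient g xstar) 0 j.
(* The invariant on the control variates minus the optimality condition at [xstar], multiplied by
   [n]. *)
have bal : \sum_i v i = - (2 * n%:R * vs) - n%:R * vy.
  have /rowP/(_ j) := bs; have /rowP/(_ j) := gs.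
  rewrite !mxE !summxE => E1 E2.
  have -> : \sum_i v i = \sum_i u_cl s i 0 j - \sum_i gradient (f i) xstar 0 j.
    by rewrite -sumrB; apply: eq_bigr => i _; rewrite /v !mxE.
  rewrite /vs /vy !mxE.
  set a := \sum_i u_cl s i 0 j in E2 *; set b := \sum_i gradient (f i) xstar 0 j in E1 *.
  have K x : x = n%:R * (n%:R^-1 * x) :> R by rewrite mulrA mulfV// mul1r.
  rewrite (K a) (K b).
  move: E1 E2; set a' := n%:R^-1 * a; set b' := n%:R^-1 * b.
  move=> E1 E2; rewrite -mulrBr.
  have -> : a' - b' = - 2 * (u_srv s 0 j - 'D_(delta_mx 0 j) fs xstar)
      - (u_y s 0 j - 'D_(delta_mx 0 j) g xstar) by lra.
  by ring.
rewrite /pot_hat /cross.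
(* The local step error is [w + gamma * v]: adding and subtracting [gamma] times the gradient at
   [xstar] compares two gradient steps and leaves the control variate error. *)
pose w i := ((x_cl s i - gamma q *: gradient (f i) (x_cl s i))
             - (xstar - gamma q *: gradient (f i) xstar)) 0 j.
pose ws := ((x_srv s - gamma q *: gradient fs (x_srv s))
             - (xstar - gamma q *: gradient fs xstar)) 0 j.
pose wy := ((y_aux s - gamma q *: gradient g (y_aux s))
             - (xstar - gamma q *: gradient g xstar)) 0 j.
have -> : (srv_hat fs q s - xstar) 0 j = ws + gamma q * vs.
  by rewrite /ws /vs !mxE; ring.
have -> : (y_hat g q s - xstar) 0 j = wy + gamma q * vy.
  by rewrite /wy /vy !mxE; ring.
have hE i : (cl_hat f q s i - xstar) 0 j = w i + gamma q * v i.
  by rewrite /w /v !mxE; ring.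
have -> : (fun i => (cl_hat f q s i - xstar) 0 j) = fun i => w i + gamma q * v i.
  exact/funext.
under [X in _ - 2 * (X + _)]eq_bigr do rewrite hE.
have g0 : 0 < gamma q by rewrite gaE invr_gt0.
exact: pot_cross_le bal.
Qed.

(** One condition on [tau] for each part: [tau <= mu / L] for the gradient steps, and
    [tau * c <= gamma] so that the dual weight [c - gamma] left by the completed square is at most
    [(1 - tau) * c]. *)
Lemma local_contraction s (tau : R) : dual_balanced s ->
  tau <= mu / L -> tau * dual_weight d q p <= gamma q ->
  \sum_j (pot_hat f fs g q p xstar s j - 2 * cross f fs g q xstar s j)
  <= (1 - tau) * lyapunov f g q p xstar s.
Proof.
move=> bs tau1 tau2.
have g0 : 0 < gamma q by rewrite gaE invr_gt0.
apply: (le_trans (ler_sum _ (fun j _ => cross_pot_hat j bs))).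
rewrite sum_pot.
rewrite /lyapunov -/(dual_weight d q p) [X in _ <= X]mulrDr; apply: lerD; last first.
  rewrite [X in _ <= X]mulrA ler_wpM2r//; last by rewrite mulrBl mul1r lerD2l lerN2.
  rewrite addr_ge0//; first by apply: sumr_ge0 => i _; exact: sqr_ge0.
  by rewrite mulr_ge0 ?sqr_ge0.
rewrite [X in _ <= X]mulrCA ler_wpM2l ?invr_ge0 ?(ltW g0)//.
have K h (x : 'rV[R]_d) : smooth L h -> strongly_convex mu h ->
    enorm (x - gamma q *: gradient h x - (xstar - gamma q *: gradient h xstar)) ^+ 2
    <= (1 - tau) * enorm (x - xstar) ^+ 2.
  move=> sh ch; rewrite gaE.
  apply: le_trans (gradient_step_contraction x xstar (ltW mu0) L0 sh ch) _.
  by rewrite ler_wpM2r ?sqr_ge0// lerD2l lerN2.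
rewrite [X in _ <= X]mulrDr [X in _ <= X + _]mulrDr; apply: lerD; first apply: lerD.
- rewrite big_distrr /=; apply: ler_sum => i _.
  exact: K (sf i) (cf i).
- by rewrite [X in _ <= X]mulrCA ler_wpM2l ?mulr_ge0//; exact: K sfs cfs.
- by rewrite [X in _ <= X]mulrCA ler_wpM2l//; exact: K sg cg.
Qed.

End Contraction.

(** * Uniform subsets and independence of the sources *)

Section UniformSubset.
Variables (R : realType) (d k : nat).
Hypothesis kd : (k <= d)%N.
Variable w : {set 'I_d} -> R.
Hypothesis w0 : forall A, 0 <= w A.
Hypothesis w1 : \sum_A w A = 1.
Hypothesis wk : forall A : {set 'I_d}, #|A| = k -> w A = 'C(d, k)%:R^-1.

Let bin_neq0 : 'C(d, k)%:R != 0 :> R.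
Proof. by rewrite pnatr_eq0 -lt0n bin_gt0. Qed.

(** The subsets of size [k] already carry total mass 1, which leaves nothing for the other
    nonnegative weights. *)
Lemma subset_weight_eq0 (A : {set 'I_d}) : #|A| != k -> w A = 0.
Proof.
move=> Ak; have : \sum_(B : {set 'I_d} | #|B| != k) w B = 0.
  apply: (addrI 1); rewrite addr0 -[RHS]w1 [RHS](bigID (fun B : {set 'I_d} => #|B| == k)) /=.
  congr (_ + _); rewrite (eq_bigr (fun=> 'C(d, k)%:R^-1)); last first.
    by move=> B /eqP; exact: wk.
  rewrite sumr_const -[LHS](mulVf bin_neq0) mulr_natr; congr (_ *+ _).
  by rewrite -[in LHS](card_ord d) -card_draws; apply: eq_card => B; rewrite inE.
by move=> /psumr_eq0P h; apply: h => //.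
Qed.

(** Counting the complement: the [k]-subsets avoiding [j] live in a set of [d.-1] elements and form
    a fraction [(d - k) / d] of all. *)
Lemma sum_subset_weight_mem j : \sum_(A : {set 'I_d} | j \in A) w A = k%:R / d%:R.
Proof.
have d0 : (0 < d)%N by apply: leq_ltn_trans (leq0n j) (ltn_ord j).
have dn : d%:R != 0 :> R by rewrite pnatr_eq0 -lt0n.
have out : \sum_(A : {set 'I_d} | j \notin A) w A = 'C(d.-1, k)%:R / 'C(d, k)%:R.
  rewrite (bigID (fun A : {set 'I_d} => #|A| == k)) /= [X in _ + X]big1 ?addr0; last first.
    by move=> A /andP[_]; exact: subset_weight_eq0.
  rewrite (eq_bigr (fun=> 'C(d, k)%:R^-1)); last first.
    by move=> A /andP[_ /eqP]; exact: wk.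
  rewrite sumr_const -[LHS]mulr_natl; congr (_ * _); congr (_%:R).
  have -> : d.-1 = #|[set~ j]%SET| by rewrite cardsC1 card_ord.
  rewrite -cards_draws; apply: eq_card => A; rewrite !inE; congr (_ && _).
  by rewrite finset.subsets_disjoint finset.setCK disjoint_sym finset.disjoints1.
have : \sum_(A : {set 'I_d} | j \in A) w A = 1 - 'C(d.-1, k)%:R / 'C(d, k)%:R.
  by rewrite -out -w1 [X in X - _](bigID (fun A : {set 'I_d} => j \in A)) /= addrK.
move=> ->.
have := congr1 (fun m => m%:R : R) (mul_bin_down d k).
rewrite !natrM natrB// => E.
have -> : 'C(d.-1, k)%:R = (d%:R - k%:R) / d%:R * 'C(d, k)%:R :> R.
  by rewrite mulrAC -E mulrAC mulfV// mul1r.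
by rewrite mulfK//; field.
Qed.

Lemma sum_subset_weight (z : 'I_d -> R) :
  \sum_A w A * (\sum_(j in A) z j) = k%:R / d%:R * \sum_j z j.
Proof.
under eq_bigr do rewrite mulr_sumr.
rewrite (exchange_big_dep predT)//= mulr_sumr; apply: eq_bigr => j _.
by rewrite -mulr_suml sum_subset_weight_mem.
Qed.

End UniformSubset.

Section SourceIndependence.
Context (R : realType) (dT : measure_display) (T : measurableType dT)
  (P : probability T R) (I : choiceType) (F : I -> set (set T)).
Hypothesis FP : independent_family P F.
Hypothesis FI : forall i, setI_closed (F i).
Hypothesis FT : forall i, F i setT.
Local Open Scope ereal_scope.

(** A pi-system generating the sigma-algebra of the sources in [Q], in the shape for which
    [independent_family] gives product formulas. *)
Definition cylinders (Q : pred I) : set (set T) :=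
  [set E | exists (J : {fset I}) (A : I -> set T),
    [/\ forall i, i \in J -> Q i, forall i, i \in J -> F i (A i)
      & E = \bigcap_(i in [set` J]) A i]].

Lemma cylinders_measurable Q : cylinders Q `<=` measurable.
Proof.
move=> _ [J [A [_ FA ->]]]; apply: fin_bigcap_measurable.
  exact: finite_fset.
by move=> i iJ; exact: (FP.1 i _ (FA i iJ)).
Qed.

Lemma cylindersT Q : cylinders Q setT.
Proof.
exists fset0, (fun=> setT); split=> //.
by apply/seteqP; split => [w _ i|w _].
Qed.

Lemma cylinders_source (Q : pred I) i H : Q i -> F i H -> cylinders Q H.
Proof.
move=> Qi FH; exists [fset i]%fset, (fun=> H); split.
- by move=> j; rewrite inE => /eqP ->.
- by move=> j; rewrite inE => /eqP ->.
- apply/seteqP; split => [w Hw j //|w h].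
  by apply: (h i); rewrite /= inE.
Qed.

Lemma cylinders_setI Q : setI_closed (cylinders Q).
Proof.
move=> _ _ [J1 [A1 [Q1 F1 ->]]] [J2 [A2 [Q2 F2 ->]]].
exists (J1 `|` J2)%fset, (fun i => (if i \in J1 then A1 i else setT)
  `&` (if i \in J2 then A2 i else setT)); split.
- by move=> i; rewrite inE => /orP[/Q1|/Q2].
- move=> i _; apply: FI; first by case: ifPn => // /F1.
  by case: ifPn => // /F2.
- apply/seteqP; split => w.
    move=> [h1 h2] i _; split.
      by case: ifPn => // iJ; exact: h1.
    by case: ifPn => // iJ; exact: h2.
  move=> h; split => i /= iJ.
    by have := (h i); rewrite /= inE iJ => /(_ isT)[].
  by have := (h i); rewrite /= inE iJ orbT => /(_ isT)[_].
Qed.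

(** The second conclusion allows iteration: the intersection is again a cylinder, over one more
    source. *)
Lemma cylinders_indep (Q : pred I) i H E : ~~ Q i -> F i H -> cylinders Q E ->
  P (H `&` E) = P H * P E /\ cylinders (predU (pred1 i) Q) (H `&` E).
Proof.
move=> nQ FH [J [A [QJ FA ->]]].
have iJ : i \notin J by apply: contra nQ; exact: QJ.
pose A' j := if j == i then H else A j.
have A'E j : j \in J -> A' j = A j.
  by rewrite /A'; case: eqP => // -> jJ; rewrite jJ in iJ.
have E1 : H `&` \bigcap_(j in [set` J]) A j
    = \bigcap_(j in [set` (i |` J)%fset]) A' j.
  apply/seteqP; split => w.
    move=> [Hw h] j /=; rewrite !inE => /orP[/eqP ->|jJ].
      by rewrite /A' eqxx.
    by rewrite A'E//; exact: h.
  move=> h; split.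
    by have := h i; rewrite /= /A' eqxx; apply; rewrite !inE eqxx.
  by move=> j /= jJ; rewrite -A'E//; apply: h; rewrite /= !inE jJ orbT.
have FA' j : j \in (i |` J)%fset -> F j (A' j).
  rewrite !inE /A'; case: eqP => [-> //|_ /= jJ]; exact: FA.
split; last first.
  exists (i |` J)%fset, A'; split => // j; rewrite !inE => /orP[->//|/QJ Qj].
  by rewrite Qj orbT.
rewrite E1 FP.2// big_fsetU1//= /A' eqxx; congr (_ * _).
rewrite FP.2//; apply: eq_big_seq => j jJ.
by rewrite -/(A' j) A'E.
Qed.

End SourceIndependence.

(** * One iteration in expectation *)

(** Moves the bounds from the sample space to the law of the seed, where the seed is the identity
    and the state can be frozen. *)
Lemma unbiased_compressor_distribution (R : realType) d dT
    (T : measurableType dT) (P : probability T R) dU (U : measurableType dU)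
    (om : R) (A : {set 'I_d}) (xi : {mfun T >-> U})
    (C : U -> 'rV[R]_d -> 'rV[R]_d) :
  unbiased_compressor P om A xi C ->
  unbiased_compressor (distribution P xi) om A idfun C.
Proof.
move=> [mC hC]; split => // x sx; have [sC EC VC] := hC x sx.
have mCx : measurable_vec (fun z => C z x).
  by apply: (measurable_compressor (xi := idfun)) => //; exact: measurable_id.
split => // [j|].
  have := EC j; rewrite !expectationE => E.
  rewrite integral_distribution//; first exact/measurable_EFinP/mCx.
  apply: (fin_integral_integrable (h := fun w => C (xi w) x 0 j)) E.
  exact: measurableT_comp (mCx j) _.
move: VC; rewrite !expectationE; apply: le_trans.
rewrite ge0_integral_distribution//.
- by apply/measurable_EFinP; apply: measurable_enorm2; exact: measurable_vecB.
- by move=> y; rewrite lee_fin sqr_ge0.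
Qed.

Lemma ge0_integral_fibers (R : realType) dT (T : measurableType dT)
    (m : {measure set T -> \bar R}) (I : finType) (h : T -> I) (f : T -> \bar R) :
  (forall i, measurable (h @^-1` [set i])) -> measurable_fun setT f ->
  (forall w, (0 <= f w)%E) ->
  (\int[m]_w f w = \sum_i \int[m]_(w in h @^-1` [set i]) f w)%E.
Proof.
move=> mh mf f0.
have TE : [set: T] = \big[setU/set0]_(i <- index_enum I) (h @^-1` [set i]).
  apply/seteqP; split => // w _; rewrite -bigcup_seq.
  by exists (h w) => //=; rewrite mem_index_enum.
rewrite {1}TE ge0_integral_bigsetU//.
- exact: index_enum_uniq.
- by apply/trivIsetP => i j _ _ ij; apply/seteqP; split => // w [/= -> /eqP]; rewrite (negbTE ij).
- by rewrite -TE.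
Qed.

Lemma preimage_set_system_setI T1 T2 (h : T1 -> T2) (G : set (set T2)) :
  setI_closed G -> setI_closed (preimage_set_system setT h G).
Proof.
move=> GI _ _ [A GA <-] [B GB <-]; exists (A `&` B); first exact: GI.
by rewrite !setTI preimage_setI.
Qed.

Section OneStep.
Variables (R : realType) (n d : nat).
Variables (f : 'I_n -> 'rV[R]_d -> R) (fs g : 'rV[R]_d -> R).
Variables (q : parameters R) (p : R) (xstar : 'rV[R]_d) (mu L : R).
Variables (om oms omav tau : R).
Hypotheses (n0 : (0 < n)%N) (d0 : (0 < d)%N) (mu0 : 0 < mu) (L0 : 0 < L).
Hypotheses (sf : forall i, smooth L (f i)) (sfs : smooth L fs)
  (sg : smooth L g).
Hypotheses (cf : forall i, strongly_convex mu (f i))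
  (cfs : strongly_convex mu fs) (cg : strongly_convex mu g).
Hypothesis xmin : forall x, objective f fs g xstar <= objective f fs g x.
Hypotheses (om0 : 0 <= om) (oms0 : 0 <= oms) (omav0 : 0 <= omav).
Hypotheses (gaE : gamma q = L^-1) (et0 : 0 < Defs.eta q).
Hypotheses (probE : forall t, prob q t = p) (p01 : 0 < p <= 1).
Hypotheses (k0 : (0 < ksize q)%N) (kd : (ksize q <= d)%N).
Hypotheses (ry : rho_y q = rho q) (ey : eta_y q = Defs.eta q).
Hypothesis hrho : rho q * (2 + omav + 2 * oms) = 1.
Hypothesis heta : Defs.eta q * (1 + 2 * om + 2 * oms) = rho q.
Hypotheses (taule1 : tau <= 1) (tau1 : tau <= mu / L)
  (tau2 : tau <= (p * (ksize q)%:R / d%:R) ^+ 2 * Defs.eta q).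

Context (dT dU dV : measure_display) (T : measurableType dT)
  (P : probability T R) (U : measurableType dU) (V : measurableType dV).
Variables (theta : nat -> T -> bool) (S : nat -> T -> {set 'I_d})
  (xi : nat -> T -> U) (zeta : nat -> T -> V)
  (C : nat -> 'I_n -> {set 'I_d} -> U -> 'rV[R]_d -> 'rV[R]_d)
  (Cs : nat -> {set 'I_d} -> V -> 'rV[R]_d -> 'rV[R]_d)
  (s0 : state R n d).
Hypothesis hcomp : compressor_bounds P om oms omav xi zeta C Cs.
Hypothesis hsrc : random_sources P (prob q) (ksize q) theta S xi zeta.
Hypothesis bal0 : dual_balanced s0.

Local Notation F := (source_events theta S xi zeta).

Let Fm i : F i `<=` measurable.
Proof. by have [[]] := hsrc. Qed.

Let FI i : setI_closed (F i).
Proof.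
by move: i => [[t|t]|[t|t]]; apply: preimage_set_system_setI => // A B mA mB;
  exact: measurableI.
Qed.

Let FT i : F i setT.
Proof.
by move: i => [[t|t]|[t|t]]; exists setT; rewrite ?setTI ?preimage_setT.
Qed.

Let F_theta t b : F (inl (inl t)) (theta t @^-1` [set b]).
Proof. by exists [set b] => //; rewrite setTI. Qed.

Let F_S t A : F (inl (inr t)) (S t @^-1` [set A]).
Proof. by exists [set A] => //; rewrite setTI. Qed.

Let F_xi t H : measurable H -> F (inr (inl t)) (xi t @^-1` H).
Proof. by exists H => //; rewrite setTI. Qed.

Let F_zeta t H : measurable H -> F (inr (inr t)) (zeta t @^-1` H).
Proof. by exists H => //; rewrite setTI. Qed.

Let mtheta t b : measurable (theta t @^-1` [set b]).
Proof. exact: Fm (F_theta t b). Qed.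

Let mS t A : measurable (S t @^-1` [set A]).
Proof. exact: Fm (F_S t A). Qed.

Let mxi t : measurable_fun setT (xi t).
Proof. by move=> _ H mH; rewrite setTI; exact: Fm (F_xi t mH). Qed.

Let mzeta t : measurable_fun setT (zeta t).
Proof. by move=> _ H mH; rewrite setTI; exact: Fm (F_zeta t mH). Qed.

Definition source_time (i : (nat + nat) + (nat + nat)) : nat :=
  match i with
  | inl (inl t) | inl (inr t) | inr (inl t) | inr (inr t) => t
  end.

Definition past_events t : set (set T) :=
  cylinders F (fun i => (source_time i < t)%N).

(* The sample space itself, with the sigma-algebra of the past, plays the role
   of the state at time t: no measurable structure on states is needed. *)
Definition past t := g_sigma_algebraType (past_events t).

Let past_m t : past_events t `<=` measurable.
Proof. by have [h _ _] := hsrc; exact: (cylinders_measurable h). Qed.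

Let mid t : measurable_fun setT (idfun : T -> past t).
Proof.
move=> _ E mE; rewrite setTI preimage_id.
exact: (smallest_sub (@sigma_algebra_measurable _ T) (@past_m t)) mE.
Qed.

Let past_source t i H : (source_time i < t)%N -> F i H ->
  measurable (H : set (past t)).
Proof.
move=> it FH; apply: sub_sigma_algebra.
exact: (cylinders_source (Q := fun i => (source_time i < t)%N)) it FH.
Qed.

Let traj := bicolor f fs g q theta S xi zeta C Cs s0.

Let mC t i A : jointly_measurable (C t i A).
Proof. by have [h _ _] := hcomp; have [] := h t i A. Qed.

Let mCs t A : jointly_measurable (Cs t A).
Proof. by have [_ h _] := hcomp; have [] := h t A. Qed.

Lemma measurable_past t : measurable_state (traj t : past t -> state R n d).
Proof.
apply: (measurable_bicolor q (ltW L0) sf sfs sg) => //.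
- move=> r rt b; apply: (past_source (i := inl (inl r))) => //; exact: F_theta.
- move=> r rt A; apply: (past_source (i := inl (inr r))) => //; exact: F_S.
- move=> r rt _ H mH; rewrite setTI.
  by apply: (past_source (i := inr (inl r))) => //; exact: F_xi.
- move=> r rt _ H mH; rewrite setTI.
  by apply: (past_source (i := inr (inr r))) => //; exact: F_zeta.
Qed.

Let Pth t b : (P (theta t @^-1` [set b]) = (if b then p else 1 - p)%:E)%E.
Proof.
have [_ h _] := hsrc.
have ht : (P (theta t @^-1` [set true]) = p%:E)%E by rewrite h probE.
case: b => //.
have -> : theta t @^-1` [set false] = ~` (theta t @^-1` [set true]).
  by apply/seteqP; split => w /=; case: (theta t w).
by rewrite probability_setC// ht.
Qed.

Let wS t (A : {set 'I_d}) : R := fine (P (S t @^-1` [set A])).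

Let PS t A : (P (S t @^-1` [set A]) = (wS t A)%:E)%E.
Proof. by rewrite /wS fineK//; exact: fin_num_measure. Qed.

Let wS_ge0 t A : 0 <= wS t A.
Proof. exact: fine_ge0. Qed.

Let wS_sum t : \sum_A wS t A = 1.
Proof.
apply: EFin_inj; rewrite -sumEFin.
under eq_bigr do rewrite -PS.
have := @ge0_integral_fibers _ _ _ P _ (S t) (cst 1%E) (mS t) (measurable_cst _).
rewrite integral_cst//= probability_setT mule1 => -> //.
by apply: eq_bigr => A _; rewrite integral_cst//= mul1e.
Qed.

Let sum_wS t (z : 'I_d -> R) :
  \sum_A wS t A * (\sum_(j in A) z j) = (ksize q)%:R / d%:R * \sum_j z j.
Proof.
apply: sum_subset_weight => // A Ak; rewrite /wS.
by have [_ _ ->] := hsrc.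
Qed.

(** For a cylinder of the past, the four sources of time [t] are peeled off one at a time;
    [indep_generated] then extends the formula to the generated sigma-algebra. *)
Lemma sources_indep t b A E H1 H2 :
  <<s past_events t >> E -> measurable H1 -> measurable H2 ->
  (P (E `&` xi t @^-1` H1 `&` (zeta t @^-1` H2
      `&` (theta t @^-1` [set b] `&` S t @^-1` [set A])))
   = ((if b then p else 1 - p) * wS t A)%:E
     * (P E * P (xi t @^-1` H1) * P (zeta t @^-1` H2)))%E.
Proof.
move=> sE mH1 mH2.
have indF : independent_family P F by have [] := hsrc.
pose Q0 : pred ((nat + nat) + (nat + nat)) := fun i => (source_time i < t)%N.
pose H := xi t @^-1` H1 `&` (zeta t @^-1` H2
   `&` (theta t @^-1` [set b] `&` S t @^-1` [set A])).
have key E' : cylinders F Q0 E' ->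
    (P (H `&` E') = (P (xi t @^-1` H1) * (P (zeta t @^-1` H2)
      * (P (theta t @^-1` [set b]) * (P (S t @^-1` [set A]) * P E')))))%E.
  move=> cE.
  have nQ i : source_time i = t -> ~~ Q0 i by rewrite /Q0 => ->; rewrite ltnn.
  have [e1 c1] := cylinders_indep indF (nQ (inl (inr t)) erefl) (F_S t A) cE.
  have [|e2 c2] := cylinders_indep indF _ (F_theta t b) c1.
    by rewrite /= nQ.
  have [|e3 c3] := cylinders_indep indF _ (F_zeta t mH2) c2.
    by rewrite /= nQ.
  have [|e4 c4] := cylinders_indep indF _ (F_xi t mH1) c3.
    by rewrite /= nQ.
  by rewrite /H -!setIA e4 e3 e2 e1.
have mH : measurable H.
  apply: measurableI; first exact: Fm (F_xi t mH1).
  apply: measurableI; first exact: Fm (F_zeta t mH2).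
  exact: measurableI.
have PH : (P H = P (xi t @^-1` H1) * (P (zeta t @^-1` H2)
      * (P (theta t @^-1` [set b]) * P (S t @^-1` [set A]))))%E.
  rewrite -[H in LHS]setIT key ?probability_setT ?mule1//.
  exact: cylindersT.
rewrite -!setIA -/H.
rewrite (indep_generated (P := P) (@past_m t) _ _ mH) => //.
- by rewrite PH Pth PS EFinM [LHS]muleC [RHS]muleC -!muleA.
- exact: cylinders_setI.
- exact: cylindersT.
- by move=> E' cE'; rewrite setIC key// PH -!muleA.
Qed.

Let xiM t : {mfun T >-> U} := HB.pack (xi t) (isMeasurableFun.Build _ _ _ _ _ (mxi t)).
Let zetaM t : {mfun T >-> V} :=
  HB.pack (zeta t) (isMeasurableFun.Build _ _ _ _ _ (mzeta t)).
Let idM t : {mfun T >-> past t} :=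
  HB.pack (idfun : T -> past t) (isMeasurableFun.Build _ _ _ _ _ (@mid t)).

Let ga0 : 0 < gamma q. Proof. by rewrite gaE invr_gt0. Qed.
Let p0 : 0 < p. Proof. by case/andP: p01. Qed.
Let kr0 : 0 < (ksize q)%:R :> R. Proof. by rewrite ltr0n. Qed.
Let dr0 : 0 < d%:R :> R. Proof. by rewrite ltr0n. Qed.

Let dw0 : 0 < dual_weight d q p.
Proof.
by rewrite /dual_weight divr_gt0// ?mulr_gt0 ?exprn_gt0.
Qed.

Let hc t : dual_weight d q p * dual_step d q t ^+ 2 = Defs.eta q / gamma q.
Proof.
rewrite /dual_weight /dual_step probE; field.
by rewrite !gt_eqF.
Qed.

(** A coordinate is communicated with probability [p * k / d]; this identity is the origin of the
    dual weight and makes the averaged cross term appear with coefficient exactly 2. *)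
Let hpk t : p * ((ksize q)%:R / d%:R) * (dual_weight d q p * dual_step d q t) = 1.
Proof.
rewrite /dual_weight /dual_step probE; field.
by rewrite !gt_eqF.
Qed.

Let rho0 : 0 < rho q.
Proof. by rewrite -heta mulr_gt0// ltr_wpDr ?mulr_ge0// ltr_wpDr ?mulr_ge0. Qed.

Let traj_balanced t w : dual_balanced (traj t w).
Proof. by elim: t => // t IH; apply: dual_balanced_step. Qed.

(** An upper bound, given the coin and the subset, on Psi averaged over the seeds. *)
Let mean_round (b : bool) t (A : {set 'I_d}) s : R :=
  \sum_j pot_hat f fs g q p xstar s j
  - (if b then 2 * dual_weight d q p * dual_step d q t
               * \sum_(j in A) cross f fs g q xstar s j else 0).

Let next t (b : bool) A s u v := bicolor_step f fs g q t b A
  (fun i A => C t i A u) (fun A => Cs t A v) s.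

Lemma conditional_expectation_le b t A s :
  (\int[distribution P (xiM t)]_u \int[distribution P (zetaM t)]_v
     (lyapunov f g q p xstar (next t b A s u v))%:E
   <= (mean_round b t A s)%:E)%E.
Proof.
have [h1 h2 h3] := hcomp.
case: b; rewrite /mean_round.
  apply: (round_expectation xstar n0 (ltW L0) sf sfs sg om0 oms0 omav0 ga0 dw0
    rho0 ry ey hrho heta (hc t)).
  - by move=> i B; apply: unbiased_compressor_distribution; exact: h1.
  - by move=> B; apply: unbiased_compressor_distribution; exact: h2.
  move=> B x sx; have := h3 t B x sx; rewrite !expectationE; apply: le_trans.
  rewrite ge0_integral_distribution//.
    apply/measurable_EFinP; apply: measurable_enorm2; apply: measurable_vecZ.
    apply: measurable_vec_sum => i; apply: measurable_vecB.
      by apply: (measurable_compressor (xi := idfun)) => //; exact: measurable_id.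
    exact: measurable_vec_cst.
  by move=> y; rewrite lee_fin sqr_ge0.
rewrite /next; under eq_integral do under eq_integral do rewrite lyapunov_local.
under eq_integral do rewrite integral_cst//= probability_setT mule1.
by rewrite integral_cst//= probability_setT mule1 subr0.
Qed.

Lemma mean_round_average t s : dual_balanced s ->
  \sum_b \sum_A (if b then p else 1 - p) * wS t A * mean_round b t A s
  <= (1 - tau) * lyapunov f g q p xstar s.
Proof.
move=> bs.
apply: (@le_trans _ _ (\sum_j (pot_hat f fs g q p xstar s j
                                - 2 * cross f fs g q xstar s j))).
  rewrite le_eqVlt; apply/orP; left; apply/eqP.
  rewrite big_bool /= /mean_round.
  set H := \sum_j pot_hat _ _ _ _ _ _ _ j; set z := 2 * _ * _.
  have -> : \sum_A p * wS t A * (H - z * \sum_(j in A) cross f fs g q xstar s j)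
      = p * H - p * z * ((ksize q)%:R / d%:R * \sum_j cross f fs g q xstar s j).
    rewrite -(sum_wS t) -[p * H]mul1r -(wS_sum t) mulr_suml.
    rewrite [X in _ = _ - X]mulr_sumr -sumrB.
    by apply: eq_bigr => A _; ring.
  have -> : \sum_A (1 - p) * wS t A * (H - 0) = (1 - p) * H.
    rewrite -[RHS]mul1r -[X in _ = X * _](wS_sum t) mulr_suml.
    by apply: eq_bigr => A _; ring.
  rewrite sumrB -mulr_sumr -/H /z.
  set X := \sum_j cross _ _ _ _ _ _ _.
  have -> : p * (2 * dual_weight d q p * dual_step d q t)
      * ((ksize q)%:R / d%:R * X)
    = 2 * (p * ((ksize q)%:R / d%:R) * (dual_weight d q p * dual_step d q t)) * X.
    by ring.
  by rewrite hpk; ring.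
apply: (local_contraction n0 mu0 L0 sf sfs sg cf cfs cg xmin gaE bs tau1).
rewrite /dual_weight -(ler_pM2r (_ : 0 < ((p * (ksize q)%:R / d%:R) ^+ 2 * Defs.eta q))).
  apply: le_trans (_ : gamma q * tau <= _); last by rewrite ler_pM2l.
  rewrite le_eqVlt; apply/orP; left; apply/eqP; field.
  by rewrite !gt_eqF.
by rewrite mulr_gt0 ?exprn_gt0 ?divr_gt0 ?mulr_gt0.
Qed.

(** The sample space is cut along the values of coin and subset. On each piece the past and the two
    seeds follow a product law; the pieces are then summed under the integral over the past, where
    the contraction holds pointwise. *)
Lemma expected_step t :
  (\int[P]_w (lyapunov f g q p xstar (traj t.+1 w))%:E
   <= (1 - tau)%:E * \int[P]_w (lyapunov f g q p xstar (traj t w))%:E)%E.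
Proof.
have lyap0 (s' : state R n d) : 0 <= lyapunov f g q p xstar s'.
  by rewrite lyapunov_pot; apply: sumr_ge0 => j _; exact: pot_ge0.
have mtraj r : measurable_state (traj r : T -> state R n d).
  by apply: (measurable_bicolor q (ltW L0) sf sfs sg).
have tau_le1 : 0 <= 1 - tau by rewrite subr_ge0.
pose h w := (theta t w, S t w).
have hE a : h @^-1` [set a] = theta t @^-1` [set a.1] `&` S t @^-1` [set a.2].
  by case: a => b A; apply/seteqP; split => w /=; [case|move=> [<- <-]].
have mh a : measurable (h @^-1` [set a]) by rewrite hE; exact: measurableI.
rewrite (ge0_integral_fibers P mh)//; last 2 first.
- by apply/measurable_EFinP; exact: (measurable_lyapunov f g q p xstar (mtraj t.+1)).
- by move=> w; rewrite lee_fin.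
pose G (a : bool * {set 'I_d}) (z : past t * U * V) : \bar R :=
  (lyapunov f g q p xstar (next t a.1 a.2 (traj t z.1.1) z.1.2 z.2))%:E.
have mG a : measurable_fun setT (G a).
  apply/measurable_EFinP.
  apply: (measurable_lyapunov f g q p xstar (s := fun z : past t * U * V =>
    next t a.1 a.2 (traj t z.1.1) z.1.2 z.2)).
  apply: (measurable_step _ (ltW L0) sf sfs sg) => //.
  - exact: measurableT_comp measurable_snd measurable_fst.
  - have m11 : measurable_fun setT (fun z : past t * U * V => z.1.1).
      exact: measurableT_comp measurable_fst measurable_fst.
    have [mx ms my [mu_ mus muy]] := measurable_past t.
    split=> [i j|j|j|].
    + exact: measurableT_comp (mx i j) m11.
    + exact: measurableT_comp (ms j) m11.
    + exact: measurableT_comp (my j) m11.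
    split=> [i j|j|j].
    + exact: measurableT_comp (mu_ i j) m11.
    + exact: measurableT_comp (mus j) m11.
    + exact: measurableT_comp (muy j) m11.
have G0 a z : (0 <= G a z)%E by rewrite lee_fin.
pose m1 := distribution P (idM t).
pose m2 := distribution P (xiM t).
pose m3 := distribution P (zetaM t).
pose I2 a x : \bar R := (\int[m2]_u \int[m3]_v G a (x, u, v))%E.
pose c (a : bool * {set 'I_d}) := (if a.1 then p else 1 - p) * wS t a.2.
have c0 a : 0 <= c a.
  rewrite /c mulr_ge0//; case: a.1; first exact: ltW.
  by rewrite subr_ge0; case/andP: p01.
have fiber a : (\int[P]_(w in h @^-1` [set a]) (lyapunov f g q p xstar (traj t.+1 w))%:E
    = (c a)%:E * \int[m1]_x I2 a x)%E.
  transitivity (\int[P]_(w in h @^-1` [set a]) G a (idM t w, xiM t w, zetaM t w))%E.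
    apply: eq_integral => w; rewrite inE /= => <-.
    by [].
  apply: integral_independent3 => //.
  move=> E H1 H2 mE mH1 mH2; rewrite hE.
  exact: sources_indep.
have mI3 a : measurable_fun setT (fun z : past t * U => \int[m3]_v G a (z, v))%E.
  exact: (@measurable_fun_fubini_tonelli_F _ _ _ _ _ m3 _ (mG a) (G0 a)).
have mI2 a : measurable_fun setT (I2 a).
  apply: (@measurable_fun_fubini_tonelli_F _ _ _ _ _ m2 _ (mI3 a)) => z.
  by apply: integral_ge0.
have I20 a x : (0 <= I2 a x)%E.
  by apply: integral_ge0 => u _; apply: integral_ge0.
under eq_bigr do rewrite fiber -ge0_integralZl_EFin//.
rewrite -ge0_integral_sum//; last 2 first.
- by move=> a; apply: measurable_funeM.
- by move=> a x _; rewrite mule_ge0// lee_fin.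
have mly : measurable_fun setT (fun x : past t => (lyapunov f g q p xstar (traj t x))%:E).
  by apply/measurable_EFinP; exact: (measurable_lyapunov f g q p xstar (measurable_past t)).
have -> : (\int[P]_w (lyapunov f g q p xstar (traj t w))%:E
    = \int[m1]_x (lyapunov f g q p xstar (traj t x))%:E)%E.
  by rewrite ge0_integral_distribution// => x; rewrite lee_fin.
rewrite -ge0_integralZl_EFin//; last by move=> x _; rewrite lee_fin.
apply: ge0_le_integral => //.
- by move=> x _; apply: sume_ge0 => a _; rewrite mule_ge0// lee_fin.
- by apply: emeasurable_sum => a; apply: measurable_funeM.
- exact: measurable_funeM.
move=> x _.
have bx : dual_balanced (traj t x) by exact: traj_balanced.
apply: (@le_trans _ _ (\sum_a (c a * mean_round a.1 t a.2 (traj t x))%:E)%E).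
  apply: lee_sum => a _; rewrite (EFinM (c a)) lee_wpmul2l ?lee_fin//.
  have := @conditional_expectation_le a.1 t a.2 (traj t x).
  by rewrite /I2 /G /=.
rewrite sumEFin -EFinM lee_fin.
apply: le_trans (mean_round_average t bx).
by rewrite le_eqVlt; apply/orP; left; apply/eqP; rewrite pair_bigA.
Qed.

End OneStep.

(** * Complexity *)

Lemma geometric_iterates (R : realType) (tau : R) (E : nat -> \bar R) (a : R) :
  tau <= 1 -> E 0%N = a%:E ->
  (forall t, (E t.+1 <= (1 - tau)%:E * E t)%E) ->
  forall t, (E t <= ((1 - tau) ^+ t * a)%:E)%E.
Proof.
move=> t1 E0 step; elim=> [|t IH]; first by rewrite E0 mul1r.
apply: le_trans (step t) _; rewrite exprS -mulrA EFinM lee_wpmul2l//.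
by rewrite lee_fin subr_ge0.
Qed.

(** Since [1 - tau <= expR (- tau)], the accuracy is reached from the ceiling of
    [ln (a / eps) / tau] on; the final [+ 1] pays for the ceiling, and the least such index is no
    larger. *)
Lemma iteration_complexity_le (R : realType) dT (T : measurableType dT)
    (P : probability T R) (Psi : nat -> T -> R) (a tau eps : R) :
  0 < tau <= 1 -> 0 < eps <= a ->
  (forall t, ('E_P[Psi t] <= ((1 - tau) ^+ t * a)%:E)%E) ->
  exists N, is_iteration_complexity P Psi eps N /\
    N%:R <= ln (a / eps) / tau + 1.
Proof.
move=> /andP[tau0 tau1] /andP[eps0 epsa] dec.
have a0 : 0 < a by exact: lt_le_trans epsa.
have l0 : 0 <= ln (a / eps) by rewrite ln_ge0// ler_pdivlMr// mul1r.
pose reached M := forall t, (M <= t)%N -> ('E_P[Psi t] <= eps%:E)%E.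
pose N0 := `|Num.ceil (ln (a / eps) / tau)|%N.
have cge0 : 0 <= Num.ceil (ln (a / eps) / tau).
  by rewrite ceil_ge0 (lt_le_trans _ (divr_ge0 l0 (ltW tau0))).
have N0E : N0%:R = (Num.ceil (ln (a / eps) / tau))%:~R :> R.
  by rewrite /N0 -[X in _ = X%:~R]gez0_abs.
have reach0 : reached N0.
  move=> t Nt; apply: le_trans (dec t) _; rewrite lee_fin.
  have le1 : 1 - tau <= expR (- tau) by exact: expR_ge1Dx.
  apply: (@le_trans _ _ (expR (- tau) ^+ t * a)).
    by rewrite ler_wpM2r ?(ltW a0)// lerXn2r// nnegrE ?subr_ge0// expR_ge0.
  rewrite -expRM_natr -ler_pdivlMr//.
  have -> : eps / a = expR (- ln (a / eps)).
    by rewrite expRN lnK ?posrE ?divr_gt0// invf_div.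
  rewrite ler_expR mulNr lerN2 -ler_pdivrMl// mulrC.
  apply: le_trans (_ : N0%:R <= _); last by rewrite ler_nat.
  by rewrite N0E; exact: ceil_ge.
have ex : exists M, `[< reached M >] by exists N0; exact/asboolP.
exists (ex_minn ex); case: ex_minnP => N /asboolP rN Nmin; split.
  by split => // M rM; apply: Nmin; exact/asboolP.
have : (N <= N0)%N by apply: Nmin; exact/asboolP.
rewrite -(ler_nat R) => /le_trans; apply; rewrite N0E.
by have := ceilB1_lt (ln (a / eps) / tau); rewrite intrB; lra.
Qed.

(* The constant K hidden in the O notation depends only on the bound W on
   omega and omega_s and on the number B of bits per real number. *)
Theorem corollary4p3 (R : realType) (W : R) (B : nat) :
  exists K : R,
  forall (n d : nat) (mu L : R) (f : 'I_n -> 'rV[R]_d -> R)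
    (fs g : 'rV[R]_d -> R) (xstar : 'rV[R]_d) (alpha : R)
    (omega omega_s omega_av : R)
    (dT dU dV : measure_display) (T : measurableType dT)
    (P : probability T R) (U : measurableType dU) (V : measurableType dV)
    (theta : nat -> T -> bool) (S : nat -> T -> {set 'I_d})
    (xi : nat -> T -> U) (zeta : nat -> T -> V)
    (C : nat -> 'I_n -> {set 'I_d} -> U -> 'rV[R]_d -> 'rV[R]_d)
    (Cs : nat -> {set 'I_d} -> V -> 'rV[R]_d -> 'rV[R]_d)
    (s0 : state R n d) (b bs : nat) (eps : R),
  let kappa := L / mu in
  let rho := (2 + omega_av + 2 * omega_s)^-1 in
  let eta :=
    ((1 + 2 * omega + 2 * omega_s) * (2 + omega_av + 2 * omega_s))^-1 in
  let k := `|Num.ceil (d%:R / Num.sqrt kappa)|%N in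
  let p := Num.min (d%:R / (k%:R * Num.sqrt (eta * kappa))) 1 in
  let q := {| Defs.gamma := L^-1; Defs.eta := eta; Defs.eta_y := eta;
              Defs.rho := rho; Defs.rho_y := rho;
              Defs.prob := fun=> p; Defs.ksize := k |} in
  let Psi t w := lyapunov f g q p xstar
                   (bicolor f fs g q theta S xi zeta C Cs s0 t w) in
  let Psi0 := lyapunov f g q p xstar s0 in
  (0 < n)%N -> (0 < d)%N -> 0 < mu <= L ->
  (forall i, smooth L (f i)) -> (forall i, strongly_convex mu (f i)) ->
  smooth L fs -> strongly_convex mu fs ->
  smooth L g -> strongly_convex mu g ->
  (forall x, objective f fs g xstar <= objective f fs g x) ->
  0 < alpha <= 1 ->
  0 <= omega <= W -> 0 <= omega_s <= W -> 0 <= omega_av <= omega ->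
  compressor_bounds P omega omega_s omega_av xi zeta C Cs ->
  random_sources P (prob q) k theta S xi zeta ->
  n%:R^-1 *: (\sum_(i < n) u_cl s0 i) + 2 *: u_srv s0 + u_y s0 = 0 ->
  (b <= B * k)%N -> (bs <= B * k)%N ->
  0 < eps <= Psi0 / 2 ->
  exists N : nat, is_iteration_complexity P Psi eps N /\
    total_com alpha b bs p N
      <= K * (d%:R * Num.sqrt kappa * ln (Psi0 / eps)).

Proof.
(* The smallest value that [eta] can take when [omega], [omega_s] and [omega_av] are at most [W]. *)
pose et0 : R := ((1 + 4 * W) * (2 + 3 * W))^-1.
(* [2 * B] bounds the bits per coordinate as [alpha <= 1]; the root comes from [k * p], [et0^-1]
   from [1 / tau], and [(ln 2)^-1] absorbs the rounding of the iteration count, because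
   [eps <= Psi0 / 2]. *)
exists (2 * B%:R / Num.sqrt et0 * (et0^-1 + (ln 2)^-1)).
move=> n d mu L f fs g xstar alpha om oms omav dT dU dV T P U V theta S xi zeta
  C Cs s0 b bs eps kappa rh et k p q Psi Psi0 n0 d0 /andP[mu0 muL] sf cf sfs cfs
  sg cg xmin /andP[al0 al1] /andP[om0 omW] /andP[oms0 omsW] /andP[omav0 omavo]
  hcomp hsrc bal bB bsB /andP[eps0 epsP].
have L0 : 0 < L by exact: lt_le_trans muL.
have kap1 : 1 <= kappa by rewrite /kappa ler_pdivlMr// mul1r.
have kap0 : 0 < kappa by exact: lt_le_trans kap1.
have sk1 : 1 <= Num.sqrt kappa by move: (kap1); rewrite -(ler_sqrt 1 (ltW kap0)) sqrtr1.
have sk0 : 0 < Num.sqrt kappa by exact: lt_le_trans sk1.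
have skE : Num.sqrt kappa ^+ 2 = kappa by rewrite sqr_sqrtr ?ltW.
have D1 : 1 <= 1 + 2 * om + 2 * oms by lra.
have D2 : 2 <= 2 + omav + 2 * oms by lra.
have D1n : 1 + 2 * om + 2 * oms != 0 by rewrite gt_eqF//; lra.
have D2n : 2 + omav + 2 * oms != 0 by rewrite gt_eqF//; lra.
have D1p : 0 < 1 + 2 * om + 2 * oms by lra.
have D2p : 0 < 2 + omav + 2 * oms by lra.
have etp : 0 < et by rewrite invr_gt0 mulr_gt0.
have et1 : et <= 1.
  rewrite invf_le1; last by rewrite mulr_gt0.
  by nra.
have W1 : 0 < 1 + 4 * W by lra.
have W2 : 0 < 2 + 3 * W by lra.
have et0p : 0 < et0 by rewrite invr_gt0 mulr_gt0.
have et0et : et0 <= et.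
  rewrite lef_pV2 ?posrE ?mulr_gt0//.
  by apply: ler_pM; lra.
have dr0 : 0 < d%:R :> R by rewrite ltr0n.
have dk0 : 0 < d%:R / Num.sqrt kappa by rewrite divr_gt0.
have ceil0 : 0 < Num.ceil (d%:R / Num.sqrt kappa) by rewrite ceil_gt0.
have kE : k%:R = (Num.ceil (d%:R / Num.sqrt kappa))%:~R :> R.
  by rewrite /k -[X in _ = X%:~R]gez0_abs// ltW.
have k0 : (0 < k)%N by rewrite absz_gt0 gt_eqF.
have kd : (k <= d)%N.
  rewrite -(ler_nat R) kE -[d%:R]/((d%:Z)%:~R) ler_int ceil_le_int.
  by rewrite ler_pdivrMr// -[X in X <= _]mulr1 ler_pM2l.
have kge : d%:R / Num.sqrt kappa <= k%:R by rewrite kE; exact: ceil_ge.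
have kr0 : 0 < k%:R :> R by rewrite ltr0n.
have set0 : 0 < Num.sqrt et by rewrite sqrtr_gt0.
have set1 : Num.sqrt et <= 1 by move: (et1); rewrite -(ler_sqrt et ler01) sqrtr1.
have p1 : p <= 1 by rewrite ge_min lexx orbT.
have sqM : Num.sqrt (et * kappa) = Num.sqrt et * Num.sqrt kappa.
  by rewrite sqrtrM// ltW.
have ple : p <= d%:R / (k%:R * (Num.sqrt et * Num.sqrt kappa)).
  by rewrite -sqM ge_min lexx.
have p0 : 0 < p.
  by rewrite lt_min ltr01 andbT divr_gt0// mulr_gt0// sqM mulr_gt0.
(* Both branches of the minimum satisfy it: the first because [et <= 1], the second because of the
   ceiling in [k]. It makes the dual contraction as good as [et / kappa]. *)
have pk : (Num.sqrt kappa)^-1 <= p * k%:R / d%:R.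
  rewrite ler_pdivlMr// mulrC -ler_pdivrMr// /p sqM le_min; apply/andP; split.
    rewrite -[X in X <= _]mulrA ler_pM2l// -invfM lef_pV2 ?posrE ?mulr_gt0//.
    by rewrite [X in _ <= X]mulrC ler_pM2l// -[X in _ <= X]mul1r ler_pM2r.
  by rewrite ler_pdivrMr// mul1r.
pose tau := et / kappa.
have tau0 : 0 < tau by rewrite divr_gt0.
have tau_mu : tau <= mu / L.
  rewrite /tau /kappa invf_div mulrC ler_piMr// divr_ge0// ltW//.
have mL1 : mu / L <= 1 by rewrite ler_pdivrMr// mul1r.
have tau1 : tau <= 1 by exact: le_trans tau_mu mL1.
have tau_pk : tau <= (p * k%:R / d%:R) ^+ 2 * et.
  rewrite /tau mulrC ler_pM2r// -skE -exprVn.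
  by rewrite lerXn2r// nnegrE ?invr_ge0 ?(ltW sk0)// ltW// divr_gt0// mulr_gt0.
have rhoE : rho q * (2 + omav + 2 * oms) = 1 by rewrite /= /rh mulVf.
have etaE : Defs.eta q * (1 + 2 * om + 2 * oms) = rho q.
  by rewrite /= /et /rh invfM mulrAC mulVf// mul1r.
have p01 : 0 < p <= 1 by rewrite p0 p1.
have step := @expected_step R n d f fs g q p xstar mu L om oms omav tau n0 d0
  mu0 L0 sf sfs sg cf cfs cg xmin om0 oms0 omav0 erefl etp (fun=> erefl) p01
  k0 kd erefl erefl rhoE etaE tau1 tau_mu tau_pk dT dU dV T P U V theta S xi
  zeta C Cs s0 hcomp hsrc bal.
have Psi00 : (\int[P]_w (Psi 0%N w)%:E = Psi0%:E)%E.
  transitivity (\int[P]_w cst Psi0%:E w)%E; first by [].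
  by rewrite integral_cst//= probability_setT mule1.
have dec t : ('E_P[Psi t] <= ((1 - tau) ^+ t * Psi0)%:E)%E.
  rewrite expectationE.
  exact: (geometric_iterates tau1 Psi00 step).
have Psi0p : 0 < Psi0 by lra.
have tau01 : 0 < tau <= 1 by rewrite tau0 tau1.
have eps01 : 0 < eps <= Psi0 by rewrite eps0 /=; lra.
have [N [NP Nle]] := iteration_complexity_le tau01 eps01 dec.
exists N; split => //.
set l := ln (Psi0 / eps) in Nle *.
have ln2 : 0 < ln 2 :> R by rewrite ln_gt0// ltr1n.
have l2 : ln 2 <= l.
  by rewrite ler_ln ?posrE ?divr_gt0// ler_pdivlMr//; lra.
have l0 : 0 < l by exact: lt_le_trans l2.
have bits : b%:R + alpha * bs%:R <= 2 * B%:R * k%:R.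
  move: bB bsB; rewrite -!(ler_nat R) !natrM => h1 h2.
  have : alpha * bs%:R <= bs%:R by rewrite ler_piMl.
  by lra.
have Nle' : N%:R <= kappa * l * (et0^-1 + (ln 2)^-1).
  apply: le_trans Nle _; rewrite mulrDr; apply: lerD.
    have -> : l / tau = kappa * l * et^-1 by rewrite /tau invf_div mulrCA mulrA.
    by rewrite (ler_pM2l (mulr_gt0 kap0 l0)) lef_pV2 ?posrE.
  rewrite ler_pdivlMr// mul1r; apply: le_trans l2 _.
  by rewrite -[X in X <= _]mul1r ler_pM2r.
rewrite /total_com.
have kp : k%:R * p <= d%:R / (Num.sqrt et0 * Num.sqrt kappa).
  rewrite mulrC -ler_pdivlMr//; apply: le_trans ple _.
  have se0 : 0 < Num.sqrt et0 by rewrite sqrtr_gt0.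
  rewrite -[X in _ <= X]mulrA ler_pM2l// -invfM lef_pV2 ?posrE ?mulr_gt0//.
  by rewrite [X in _ <= X]mulrC ler_pM2r// ler_pM2r// ler_sqrt// ltW.
apply: (@le_trans _ _ (2 * B%:R * (k%:R * p) * N%:R)).
  by rewrite mulrA ler_wpM2r// ler_wpM2r// ltW.
apply: (@le_trans _ _ (2 * B%:R * (d%:R / (Num.sqrt et0 * Num.sqrt kappa))
   * (kappa * l * (et0^-1 + (ln 2)^-1)))).
  apply: ler_pM => //.
    by rewrite !mulr_ge0// ltW.
  by rewrite ler_wpM2l// mulr_ge0.
rewrite le_eqVlt; apply/orP; left; apply/eqP.
have se0 : Num.sqrt et0 != 0 by rewrite gt_eqF// sqrtr_gt0.
have e0 : et0 != 0 by rewrite gt_eqF.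
have l20 : ln 2 != 0 :> R by rewrite gt_eqF.
have k00 : Num.sqrt kappa != 0 by rewrite gt_eqF.
move: (ln 2) (Num.sqrt kappa) (Num.sqrt et0) l20 k00 se0 skE.
move=> c2 sk se h1 h2 h3 <-.
by field; rewrite h1 h2 h3 e0.
Qed.
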